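(* Let $\Sigma_t$ be the follower's estimation error covariance of $x_*$ at time $t$, i.e. $\Sigma_t=\mathrm{Cov}(x_*-x_*^{(t)})$, under the generalized implicit coordination scheme described in the context. If there is a $\sigma>0$ such that $\Lambda_t(j)\ge\sigma$ for all $t$ and all $j\in\{1,\dots,r\}$, then for any $i\ge0$, $$\mathrm{Tr}(\Sigma_{(i+1)\tau})\le\frac{1+\sigma\pi}{1+2\sigma\pi}\,\mathrm{Tr}(\Sigma_{i\tau}),$$ where $\pi=\min_j\Pi_1(j)$ is the minimum diagonal entry of $\Pi_1$.
   Context: All matrices are real; $M^{1/2}$ is the symmetric positive (semi-)definite square root. For a diagonal matrix $D$, $D(j)$ denotes its $j$-th diagonal entry. System. $x_{t+1}=Ax_t+B_1v_t+B_2q_t+w_t$, $t=0,1,2,\dots$, with $x_t\in\mathbb{R}^{d_0}$, leader input $v_t\in\mathbb{R}^{d_1}$, follower input $q_t\in\mathbb{R}^{d_2}$, and $w_t\sim\mathcal N(0,W)$ with $W\succ0$. The initial state is $x_0\sim\mathcal N(0,X_0)$, and the target state is $x_*\sim\mathcal N(0,\Sigma_0)$ with $\Sigma_0\succ0$. The variables $x_0$, $x_*$, $w_0,w_1,\dots$ are mutually independent. Put $B=[B_1\ B_2]$; $(A,B)$ is controllable. Both agents observe $x_t$ perfectly; only the leader knows $x_*$. The leader is under-actuated: $\mathrm{rank}(B_1)=r<d_0$, and $\tau=d_0/r$ is assumed to be an integer. The horizon length is an arbitrary $n$; statements about time $t$ refer to times not exceeding $n$. Gains. Let $F,F_n,G_1,G_2$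 be positive semi-definite cost matrices and $G=\mathrm{diag}(G_1,G_2)$ (block diagonal). Set $\Phi_n=\bar D_n=F_n$, and for $0\le t\le n-1$ (inverses assumed to exist): $K_t=(G+B^\top\Phi_{t+1}B)^{-1}B^\top\Phi_{t+1}A$, $D_t=(G+B^\top\Phi_{t+1}B)^{-1}B^\top\bar D_{t+1}$ with $\bar D_t=(A-BK_t)^\top\bar D_{t+1}+F$, and $\Phi_t=F+A^\top\Phi_{t+1}A-A^\top\Phi_{t+1}B(G+B^\top\Phi_{t+1}B)^{-1}B^\top\Phi_{t+1}A$. Partition the rows as $K_t=\begin{bmatrix} K_t^l \\ K_t^f \end{bmatrix}$, $D_t=\begin{bmatrix} D_t^l \\ D_t^f \end{bmatrix}$ (first $d_1$ rows, last $d_2$ rows). Channel decomposition. Take an SVD $B_1=\Gamma_0\bar\Psi_1\Gamma_1^\top$, with $\Gamma_0\in\mathbb{R}^{d_0\times d_0}$ and $\Gamma_1\in\mathbb{R}^{d_1\times d_1}$ unitary and $\bar\Psi_1=\begin{bmatrix}\Psi_1&0\\0&0\end{bmatrix}$, where $\Psi_1\in\mathbb{R}^{r\times r}$ is diagonal with the positive singular values of $B_1$ on its diagonal. Let $\bar W=\Gamma_0^\top W\Gamma_0$ and let $\bar W_1$ be its upper-left $r\times r$ block. Write $\Psi_1\bar W_1^{-1}\Psi_1=U_1\Pi_1U_1^\top$ with $U_1$ real unitary and $\Pi_1$ diagonal ($r\times r$). The deterministic positive definite matrices $S_t\in\mathbb{R}^{r\times r}$ have the form $S_t=U_1\Lambda_tU_1^\top$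 with $\Lambda_t$ diagonal. For $k\in\{0,\dots,\tau-1\}$, $P_k=[0\ \ I_r\ \ 0]\in\mathbb{R}^{r\times d_0}$, with $I_r$ occupying columns $kr+1,\dots,(k+1)r$. Generalized implicit coordination scheme (Algorithm 2). Initialize $e_0=x_*$, $x_*^{(0)}=0$, $c_0=0$. For $t=0,\dots,n-1$, with $\Sigma_t=\mathrm{Cov}(e_t)$: (1) $k=t\bmod\tau$; (2) $\tilde s_t=S_t^{1/2}P_k\Sigma_t^{-1/2}e_t\in\mathbb{R}^r$ and $s_t=\Gamma_1\begin{bmatrix}\tilde s_t\\0\end{bmatrix}$ (with $d_1-r$ zeros); (3) apply $v_t=-K_t^lx_t+c_t^l+s_t$ and $q_t=-K_t^fx_t+c_t^f$, where $c_t=[c_t^l,c_t^f]=D_tx_*^{(t)}$, i.e. $c_t^l=D_t^lx_*^{(t)}$ and $c_t^f=D_t^fx_*^{(t)}$; observe $x_{t+1}$; (4) let $\tilde y_t$ be the first $r$ entries of $\Gamma_0^\top(x_{t+1}-(A-BK_t)x_t-Bc_t)$; (5) $\hat e_t=\mathbb{E}[e_t\mid\tilde y_t]=\Sigma_t^{1/2}P_k^\top S_t^{1/2}\Psi_1(\Psi_1S_t\Psi_1+\bar W_1)^{-1}\tilde y_t$; (6) $e_{t+1}=e_t-\hat e_t$ and $x_*^{(t+1)}=x_*^{(t)}+\hat e_t$. Thus $x_*^{(t)}$ is the follower's estimate of $x_*$ at time $t$, and $e_t=x_*-x_*^{(t)}$ is its estimation error. *)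

(* Defs.v *)
From HB Require Import structures.
From mathcomp Require Import all_boot all_order all_algebra.
From mathcomp Require Import all_classical all_reals all_analysis.
Set Implicit Arguments.
Unset Strict Implicit.
Unset Printing Implicit Defensive.
Import Order.TTheory GRing.Theory Num.Theory.
Local Open Scope classical_set_scope.
Local Open Scope ring_scope.

Section matrices.
Context {R : realType}.

Definition psdmx m (M : 'M[R]_m) : Prop :=
  M^T = M /\ forall u : 'cV[R]_m, 0 <= (u^T *m M *m u) 0 0.

Definition pdmx m (M : 'M[R]_m) : Prop :=
  M^T = M /\ forall u : 'cV[R]_m, u != 0 -> 0 < (u^T *m M *m u) 0 0.

Definition orthogonalmx m (Q : 'M[R]_m) : Prop := Q^T *m Q = 1%:M.

(* The symmetric positive semi-definite square root M^(1/2). It is unique when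
   it exists, hence when [M] is positive semi-definite; it is 0 otherwise. *)
Definition sqrtmx m (M : 'M[R]_m) : 'M[R]_m :=
  xget 0 [set Q : 'M[R]_m | psdmx Q /\ Q *m Q = M].

(* Full row rank of the controllability matrix [B AB ... A^(m-1)B]. *)
Definition controllable m p (A : 'M[R]_m) (B : 'M[R]_(m, p)) : Prop :=
  \rank (\mxrow_(k < m) (A ^+ k *m B)) = m.

Definition is_min_entry m (u : 'rV[R]_m) (c : R) : Prop :=
  (exists j, u 0 j = c) /\ (forall j, c <= u 0 j).

(* The r x m matrix [0 I_r 0] whose identity block occupies the columns
   k * r, ..., (k + 1) * r - 1, counted from 0. *)
Definition select_block r m (k : nat) : 'M[R]_(r, m) :=
  \matrix_(i < r, j < m) ((j : nat) == k * r + i)%N%:R.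

End matrices.

Arguments select_block {R} r m k.

Section random_vectors.
Context d (T : measurableType d) (R : realType) (P : probability T R).

Definition sigma_rv m (X : T -> 'cV[R]_m) : set (set T) :=
  <<s [set E | exists i (B : set R),
         measurable B /\ E = (fun om => X om i 0) @^-1` B] >>.

(* Mutual independence of a sequence of random vectors: the product rule for
   every finite subfamily of the sigma-algebras they generate. *)
Definition mutually_independent m (Z : nat -> T -> 'cV[R]_m) : Prop :=
  forall (J : seq nat) (E : nat -> set T), uniq J ->
    (forall j, j \in J -> sigma_rv (Z j) (E j)) ->
    P (\bigcap_(j in [set` J]) E j) = (\prod_(j <- J) P (E j))%E.

(* Centred real normal law of variance v. The case v = 0 is separated because
   the library's [normal_prob m 0] is not the Dirac mass at m. *)
Definition centered_normal (X : T -> R) (v : R) : Prop :=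
  measurable_fun [set: T] X /\
  forall B : set R, measurable B ->
    P (X @^-1` B) = if v == 0 then \d_(0 : R) B
                    else normal_prob 0 (Num.sqrt v) B.

(* X ~ N(0, M): every linear form of X is normal; degenerate M is allowed. *)
Definition gaussian_vector m (X : T -> 'cV[R]_m) (M : 'M[R]_m) : Prop :=
  forall a : 'cV[R]_m,
    centered_normal (fun om => (a^T *m X om) 0 0) ((a^T *m M *m a) 0 0).

Definition covmx m (X : T -> 'cV[R]_m) : 'M[R]_m :=
  \matrix_(i, j)
    fine (covariance P (fun om => X om i 0) (fun om => X om j 0)).

(* Z is a version of the conditional expectation E[X | Y]. *)
Definition is_cond_expectation m p (X : T -> 'cV[R]_m) (Y : T -> 'cV[R]_p)
    (Z : T -> 'cV[R]_m) : Prop :=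
  forall i : 'I_m,
    [/\ forall B : set R, measurable B ->
          sigma_rv Y ((fun om => Z om i 0) @^-1` B),
        P.-integrable [set: T] (fun om => (Z om i 0)%:E) &
        forall E, sigma_rv Y E ->
          (\int[P]_(om in E) (Z om i 0)%:E =
           \int[P]_(om in E) (X om i 0)%:E)%E].

End random_vectors.

Section coordination.
Context {R : realType}.

(* The backward recursions for Phi_t, Dbar_t and the gains K_t, D_t, including
   the existence of the inverses. *)
Record lq_gains (n d0 p : nat) (A : 'M[R]_d0) (B : 'M[R]_(d0, p))
    (F Fn : 'M[R]_d0) (G : 'M[R]_p)
    (Phi Dbar : nat -> 'M[R]_d0) (K D : nat -> 'M[R]_(p, d0)) : Prop := {
  lq_Phi_end : Phi n = Fn;
  lq_Dbar_end : Dbar n = Fn;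
  lq_inv : forall t, (t < n)%N -> G + B^T *m Phi t.+1 *m B \in unitmx;
  lq_K : forall t, (t < n)%N ->
    K t = invmx (G + B^T *m Phi t.+1 *m B) *m B^T *m Phi t.+1 *m A;
  lq_D : forall t, (t < n)%N ->
    D t = invmx (G + B^T *m Phi t.+1 *m B) *m B^T *m Dbar t.+1;
  lq_Dbar : forall t, (t < n)%N ->
    Dbar t = (A - B *m K t)^T *m Dbar t.+1 + F;
  lq_Phi : forall t, (t < n)%N ->
    Phi t = F + A^T *m Phi t.+1 *m A
            - A^T *m Phi t.+1 *m B *m invmx (G + B^T *m Phi t.+1 *m B)
              *m B^T *m Phi t.+1 *m A }.

(* [pid_mx r] is [I_r 0], its transpose, or [I_r 0; 0 0], according to its
   dimensions. Hence [pid_mx r *m M *m pid_mx r] is the upper-left r x r block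
   of M, or the zero-padding of the r x r matrix M, and [pid_mx r *m u] is the
   vector of the first r entries of u, or the zero-padding of u. *)
Definition Wbar1 d0 (r : nat) (Gamma0 W : 'M[R]_d0) : 'M[R]_r :=
  pid_mx r *m (Gamma0^T *m W *m Gamma0) *m pid_mx r.

(* The SVD of B1 and the spectral decomposition of Psi1 Wbar1^-1 Psi1. *)
Record channel_decomposition (d0 d1 r : nat) (B1 : 'M[R]_(d0, d1))
    (W Gamma0 : 'M[R]_d0) (Gamma1 : 'M[R]_d1) (psi : 'rV[R]_r)
    (U1 : 'M[R]_r) (Pi1 : 'rV[R]_r) : Prop := {
  ch_Gamma0 : orthogonalmx Gamma0;
  ch_Gamma1 : orthogonalmx Gamma1;
  ch_psi : forall j, 0 < psi 0 j;
  ch_svd : B1 = Gamma0 *m (pid_mx r *m diag_mx psi *m pid_mx r) *m Gamma1^T;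
  ch_U1 : orthogonalmx U1;
  ch_Pi1 : diag_mx psi *m invmx (Wbar1 r Gamma0 W) *m diag_mx psi
           = U1 *m diag_mx Pi1 *m U1^T }.

(* The closed-loop processes generated on the horizon 0, ..., n by the system
   and the generalized implicit coordination scheme. Processes are indexed by
   time first; [xhat t] is the follower's estimate of the target [xs], [e t]
   its estimation error, [c t] stacks the leader's and the follower's parts. *)
Record implicit_coordination d (T : measurableType d) (P : probability T R)
    (n d0 d1 d2 r tau : nat)
    (A : 'M[R]_d0) (B1 : 'M[R]_(d0, d1)) (B2 : 'M[R]_(d0, d2)) (W : 'M[R]_d0)
    (K D : nat -> 'M[R]_(d1 + d2, d0))
    (Gamma0 : 'M[R]_d0) (Gamma1 : 'M[R]_d1) (Psi1 : 'M[R]_r)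
    (S : nat -> 'M[R]_r)
    (x0 xs : T -> 'cV[R]_d0) (w : nat -> T -> 'cV[R]_d0)
    (x : nat -> T -> 'cV[R]_d0) (v : nat -> T -> 'cV[R]_d1)
    (q : nat -> T -> 'cV[R]_d2) (c : nat -> T -> 'cV[R]_(d1 + d2))
    (stilde : nat -> T -> 'cV[R]_r) (s : nat -> T -> 'cV[R]_d1)
    (ytilde : nat -> T -> 'cV[R]_r)
    (e ehat xhat : nat -> T -> 'cV[R]_d0) : Prop := {
  ic_x_init : x 0%N = x0;
  ic_x : forall t om, (t < n)%N ->
    x t.+1 om = A *m x t om + B1 *m v t om + B2 *m q t om + w t om;
  ic_e_init : e 0%N = xs;
  ic_xhat_init : xhat 0%N = (fun=> 0);
  ic_stilde : forall t om, (t < n)%N ->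
    stilde t om = sqrtmx (S t) *m select_block r d0 (t %% tau)
                  *m invmx (sqrtmx (covmx P (e t))) *m e t om;
  ic_s : forall t om, (t < n)%N ->
    s t om = Gamma1 *m (pid_mx r *m stilde t om);
  ic_c : forall t om, (t < n)%N -> c t om = D t *m xhat t om;
  ic_v : forall t om, (t < n)%N ->
    v t om = - (usubmx (K t) *m x t om) + usubmx (c t om) + s t om;
  ic_q : forall t om, (t < n)%N ->
    q t om = - (dsubmx (K t) *m x t om) + dsubmx (c t om);
  ic_ytilde : forall t om, (t < n)%N ->
    ytilde t om = pid_mx r *m
      (Gamma0^T *m (x t.+1 om - (A - row_mx B1 B2 *m K t) *m x t om
                    - row_mx B1 B2 *m c t om));
  ic_ehat_cond : forall t, (t < n)%N ->
    is_cond_expectation P (e t) (ytilde t) (ehat t);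
  (* The scheme evaluates the conditional expectation through this version. *)
  ic_ehat : forall t om, (t < n)%N ->
    ehat t om = sqrtmx (covmx P (e t)) *m (select_block r d0 (t %% tau))^T
                *m sqrtmx (S t) *m Psi1
                *m invmx (Psi1 *m S t *m Psi1 + Wbar1 r Gamma0 W)
                *m ytilde t om;
  ic_e : forall t om, (t < n)%N -> e t.+1 om = e t om - ehat t om;
  ic_xhat : forall t om, (t < n)%N -> xhat t.+1 om = xhat t om + ehat t om }.

End coordination.

(* Main.v *)
Require Import Defs.
From HB Require Import structures.
From mathcomp Require Import all_boot all_order all_algebra.
From mathcomp Require Import complex ring lra.
From mathcomp Require Import all_classical all_reals all_analysis.
From mathcomp Require Import measurable_realfun.
Set Implicit Arguments.
Unset Strict Implicit.
Unset Printing Implicit Defensive.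
Import Order.TTheory GRing.Theory Num.Theory.
Import numFieldNormedType.Exports.
Local Open Scope classical_set_scope.
Local Open Scope ring_scope.

(* Since e_t is a linear function of xs, w_0, ..., w_(t-1), it is uncorrelated
   with w_t, and the update gives, with H the square root of Sigma_t,
     Sigma_(t+1) = Sigma_t - H P_k^T M_t P_k H,
     M_t = S_t^(1/2) Psi (Psi S_t Psi + W1)^-1 Psi S_t^(1/2).
   As S_t >= sigma and Psi W1^-1 Psi >= pi in the Loewner order,
   M_t >= delta := sigma pi / (1 + sigma pi), hence Sigma is nonincreasing and
     tr Sigma_(t+1) <= tr Sigma_t - delta tr (P_k Sigma_t P_k^T).
   Over one period the blocks P_k sweep all coordinates and Sigma_t dominates
   the final covariance, so that (1 + delta) tr Sigma_((i+1) tau) is at most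
   tr Sigma_(i tau); and 1 / (1 + delta) is the stated factor. *)

(** * Quadratic forms and square roots *)

Section quadratic_forms.
Context {R : realType}.

(** The gains and costs drop out of the error dynamics: [ytilde] is built from [x t.+1] after
    subtracting all feedback terms, and what remains is [B1 s_t + w_t]. The scheme is thus a linear
    channel with signal covariance [S_t] and noise covariance [W1]. With T = S_t^(1/2) Psi and X = T
    W1^-1 T^T one has M_t = (1 + X^-1)^-1, and X >= a := sigma pi gives M_t >= 1 / (1 + 1/a) =
    delta. Two obstacles shape the rest. The recursion concerns covariances, which are integrals,
    whereas the data are laws of linear forms and independence of sigma-algebras. Means and mixed
    moments are obtained from the symmetry of the centred normal law, so that only its second moment
    is integrated. Moreover the scheme applies Sigma_t^(-1/2), so positive definiteness of Sigma_t
    has to be carried through the induction. *)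

Definition qform m (M : 'M[R]_m) (u : 'cV[R]_m) : R := (u^T *m M *m u) 0 0.

Lemma qformD m (M N : 'M[R]_m) u : qform (M + N) u = qform M u + qform N u.
Proof. by rewrite /qform mulmxDr mulmxDl mxE. Qed.

Lemma qformN m (M : 'M[R]_m) u : qform (- M) u = - qform M u.
Proof. by rewrite /qform mulmxN mulNmx mxE. Qed.

Lemma qformB m (M N : 'M[R]_m) u : qform (M - N) u = qform M u - qform N u.
Proof. by rewrite qformD qformN. Qed.

Lemma qformZ m (M : 'M[R]_m) c u : qform (c *: M) u = c * qform M u.
Proof. by rewrite /qform -scalemxAr -scalemxAl mxE. Qed.

Lemma qform_congr m p (M : 'M[R]_m) (N : 'M[R]_(m, p)) u :
  qform (N^T *m M *m N) u = qform M (N *m u).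
Proof. by rewrite /qform trmx_mul !mulmxA. Qed.

Lemma qform_diag m (D : 'rV[R]_m) u :
  qform (diag_mx D) u = \sum_j D 0 j * u j 0 ^+ 2.
Proof.
rewrite /qform mxE; apply: eq_bigr => j _.
by rewrite mul_mx_diag !mxE expr2 mulrA [X in X * _]mulrC.
Qed.

Lemma qform1 m u : qform (1%:M : 'M[R]_m) u = \sum_j u j 0 ^+ 2.
Proof.
rewrite -(diag_const_mx) qform_diag.
by apply: eq_bigr => j _; rewrite mxE mul1r.
Qed.

Lemma qform1_ge0 m u : 0 <= qform (1%:M : 'M[R]_m) u.
Proof. by rewrite qform1 sumr_ge0// => j _; rewrite sqr_ge0. Qed.

Lemma qform1_gt0 m (u : 'cV[R]_m) : u != 0 -> 0 < qform 1%:M u.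
Proof.
move=> u0; rewrite lt_def qform1_ge0 andbT; apply: contra_neq u0.
rewrite qform1 => /eqP; rewrite psumr_eq0 => [/allP u0|j _]; last first.
  exact: sqr_ge0.
apply/matrixP => i j; rewrite ord1 mxE; apply/eqP.
by have := u0 i (mem_index_enum i); rewrite sqrf_eq0.
Qed.

Lemma qform1_orthogonal m (Q : 'M[R]_m) u :
  orthogonalmx Q -> qform 1%:M (Q *m u) = qform 1%:M u.
Proof. by move=> Qo; rewrite -qform_congr mulmx1 Qo. Qed.

Lemma qform1_expand m (x y : 'cV[R]_m) c :
  qform 1%:M (x - c *: y) =
  qform 1%:M x - c *+ 2 * (x^T *m y) 0 0 + c ^+ 2 * qform 1%:M y.
Proof.
rewrite !qform1 mxE !mulr_sumr -sumrB -big_split; apply: eq_bigr => j _ /=.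
by rewrite !mxE; ring.
Qed.

Lemma pdmx_psdmx m (M : 'M[R]_m) : pdmx M -> psdmx M.
Proof.
move=> [Ms Mp]; split => // u; have [->|/Mp/ltW//] := eqVneq u 0.
by rewrite mulmx0 mxE.
Qed.

(** A nonzero row [k] with [k *m M^T = 0] would make the quadratic form vanish at [k^T]. *)
Lemma pdmx_unit m (M : 'M[R]_m) : pdmx M -> M \in unitmx.
Proof.
move=> [Ms Mp]; rewrite -unitmx_tr -row_free_unit -kermx_eq0.
apply/eqP/row_matrixP => i; apply/eqP; rewrite row0; apply/negP => /negP k0.
set k := row i _ in k0; have kM : k *m M^T = 0.
  by apply/eqP; rewrite -sub_kermx row_sub.
have : (k^T)%R != 0 by rewrite trmx_eq0.
by move/Mp; rewrite trmxK -[X in k *m X]Ms kM mul0mx mxE ltxx.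
Qed.

Lemma psdmx_congr m p (M : 'M[R]_m) (N : 'M[R]_(m, p)) :
  psdmx M -> psdmx (N^T *m M *m N).
Proof.
move=> [Ms Mp]; split; first by rewrite !trmx_mul trmxK Ms mulmxA.
by move=> u; rewrite -/(qform _ _) qform_congr; exact: Mp.
Qed.

Lemma psdmxD m (M N : 'M[R]_m) : psdmx M -> psdmx N -> psdmx (M + N).
Proof.
move=> [Ms Mp] [Ns Np]; split; first by rewrite raddfD /= Ms Ns.
by move=> u; rewrite -/(qform _ _) qformD addr_ge0//; [exact: Mp|exact: Np].
Qed.

Lemma pdmxD m (M N : 'M[R]_m) : psdmx M -> pdmx N -> pdmx (M + N).
Proof.
move=> [Ms Mp] [Ns Np]; split; first by rewrite raddfD /= Ms Ns.
by move=> u u0; rewrite -/(qform _ _) qformD ltr_wpDl//; [exact: Mp|exact: Np].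
Qed.

(** The left inverse [N'] supplies the injectivity of [N], which may be a tall rectangular
    matrix. *)
Lemma pdmx_congr m p (M : 'M[R]_m) (N : 'M[R]_(m, p)) (N' : 'M[R]_(p, m)) :
  N' *m N = 1%:M -> pdmx M -> pdmx (N^T *m M *m N).
Proof.
move=> N'N [Ms Mp]; split; first by rewrite !trmx_mul trmxK Ms mulmxA.
move=> u u0; rewrite -/(qform _ _) qform_congr; apply: Mp.
apply: contra_neq u0 => /(congr1 (mulmx N')).
by rewrite mulmxA N'N mul1mx mulmx0.
Qed.

Lemma trmx_inv_sym m (M : 'M[R]_m) : M^T = M -> (invmx M)^T = invmx M.
Proof. by move=> Ms; rewrite trmx_inv Ms. Qed.

Lemma pdmx_inv m (M : 'M[R]_m) : pdmx M -> pdmx (invmx M).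
Proof.
move=> Mpd; have Mu := pdmx_unit Mpd.
have -> : invmx M = (invmx M)^T *m M *m invmx M.
  by rewrite trmx_inv_sym ?Mpd.1// mulVmx// mul1mx.
by apply: pdmx_congr Mpd; exact: mulmxV.
Qed.

Lemma mxtrace_psdmx_ge0 m (M : 'M[R]_m) : psdmx M -> 0 <= \tr M.
Proof.
move=> [_ Mp]; apply: sumr_ge0 => i _; have := Mp (delta_mx i 0).
by rewrite trmx_delta -rowE -colE !mxE.
Qed.

End quadratic_forms.

Section square_root.
Context {R : realType}.

(** Newton's scheme: a new node is served by a multiple of the polynomial that vanishes at the nodes
    already treated. Repetitions in [s] are allowed, as a spectrum has multiplicities. *)
Lemma poly_interpolation (F : fieldType) (s : seq F) (f : F -> F) :
  exists p : {poly F}, forall x, x \in s -> p.[x] = f x.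
Proof.
elim: s => [|x s [p pf]]; first by exists 0.
have [xs|xs] := boolP (x \in s).
  by exists p => y /[!inE] /predU1P[->|]; exact: pf.
pose q := \prod_(y <- s) ('X - y%:P).
exists (p + ((f x - p.[x]) / q.[x]) *: q) => y.
rewrite inE !hornerE => /predU1P[->|ys].
  rewrite divfK; first by rewrite addrC subrK.
  by apply: contra xs; rewrite -root_prod_XsubC.
have /rootP -> : root q y by rewrite root_prod_XsubC.
by rewrite mulr0 addr0 pf.
Qed.

(** The diagonalization lives over the larger field [C], but [p] has coefficients in [F]; the
    identity is checked on the diagonal over [C] and brought back by injectivity of [map_mx f]. *)
Lemma horner_mx_similar_diagX (F C : fieldType) (f : {rmorphism F -> C}) m k
    (M : 'M[F]_m.+1) (V : 'M[C]_m.+1) (x : 'rV[F]_m.+1) (p : {poly F}) :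
  V \in unitmx -> map_mx f M = invmx V *m diag_mx (map_mx f x) *m V ->
  (forall j, p.[x 0 j] ^+ k = x 0 j) -> horner_mx M p ^+ k = M.
Proof.
move=> Vu ME px; apply: (@map_mx_inj _ _ f).
rewrite -rmorphXn/= map_horner_mx ME horner_mx_uconjC// horner_mx_diag.
congr (_ *m diag_mx _ *m _); apply/matrixP => i j; rewrite !mxE ord1.
by rewrite horner_map/= horner_exp px.
Qed.

Lemma psdmx_eigenvalue_ge0 m (M : 'M[R]_m) x :
  psdmx M -> eigenvalue M x -> 0 <= x.
Proof.
move=> [_ Mp] /eigenvalueP[v vM v0].
have vT0 : v^T != 0 by rewrite trmx_eq0.
have := Mp v^T; rewrite trmxK vM -scalemxAl mxE.
by have := qform1_gt0 vT0; rewrite /qform trmxK mulmx1 => /pmulr_lge0 ->.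
Qed.

(* A real polynomial p with p(x) = x^(1/4) on the spectrum gives a real symmetric
   N = p(M) with N^4 = M, although M is diagonalized over R[i] only; and N^2 is
   positive semi-definite because it is N^T N. *)
Lemma psdmx_sqrt_ex m (M : 'M[R]_m) :
  psdmx M -> exists Q, psdmx Q /\ Q *m Q = M.
Proof.
case: m M => [|m] M psdM.
  exists 0; split; last by apply/matrixP => -[].
  by split => [|u]; rewrite ?trmx0// mulmx0 mul0mx mxE.
pose A := map_mx (real_complex R) M.
have Asym : A^T = A.
  by apply/matrixP => i j; rewrite !mxE -{1}psdM.1 mxE.
have Areal : A \is a mxOver Num.real.
  by apply/mxOverP => i j; rewrite mxE /= complex_real.
have Aherm : A \is hermsymmx.
  apply: realsym_hermsym Areal.
  by apply/is_hermitianmxP; rewrite expr0 scale1r map_mx_id.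
have /orthomx_spectralP Adiag := hermitian_normalmx Aherm.
have /mxOverP dreal := hermitian_spectral_diag_real Aherm.
move: Adiag dreal; have := spectral_unit A.
set V := spectralmx A; set D := spectral_diag A => Vu Adiag dreal.
pose x := map_mx (@complex.Re R) D.
have Dx : D = map_mx (real_complex R) x.
  apply/matrixP => i j; rewrite !mxE.
  have /complex_realP[y ->] := dreal i j; by [].
(* Row [j] of [V] is a complex left eigenvector; the eigenvalue descends to the real matrix as a
   root of the characteristic polynomial. *)
clearbody x; have x_eig j : eigenvalue M (x 0 j).
  rewrite eigenvalue_root_char -(fmorph_root (real_complex R)) map_char_poly.
  rewrite -eigenvalue_root_char; apply/eigenvalueP; exists (row j V).
    rewrite -/A -row_mul Adiag !mulmxA mulmxV// mul1mx.
    by rewrite row_mul row_diag_mx Dx mxE -scalemxAl -rowE.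
  apply/eqP => /(congr1 (mulmxr (invmx V))) /=; rewrite -row_mul mulmxV// mul0mx.
  by move/rowP/(_ j); rewrite !mxE eqxx => /eqP; rewrite oner_eq0.
have [p pE] := poly_interpolation [seq x 0 j | j : 'I_m.+1]
  (fun y => Num.sqrt (Num.sqrt y)).
pose N := horner_mx M p.
have NE : N ^+ 4 = M.
  rewrite Dx in Adiag; apply: (horner_mx_similar_diagX Vu Adiag) => j.
  rewrite pE ?map_f ?mem_enum// (exprM _ 2 2) !sqr_sqrtr ?sqrtr_ge0//.
  exact: psdmx_eigenvalue_ge0 psdM (x_eig j).
(* Transposition reverses products, so the induction on [p] also uses that a polynomial in [M]
   commutes with [M]. *)
have Ns : N^T = N.
  rewrite /N; elim/poly_ind: p {pE N NE} => [|p c IH]; first by rewrite !raddf0.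
  rewrite rmorphD rmorphM/= horner_mx_X horner_mx_C -mulmxE raddfD /= trmx_mul.
  rewrite IH psdM.1 tr_scalar_mx; congr (_ + _).
  by have := congr1 (horner_mx M) (mulrC 'X p); rewrite !rmorphM/= horner_mx_X.
exists (N *m N); split.
  rewrite -{1}Ns -[_ *m _]/(N^T *m N) -[N^T]mulmx1.
  apply: psdmx_congr; apply: pdmx_psdmx; split; first by rewrite tr_scalar_mx.
  exact: qform1_gt0.
by rewrite -[RHS]NE !exprS expr0 mulr1 -!mulmxE !mulmxA.
Qed.

(** Existence turns the choice made by [xget] into a genuine root; these two properties are the
    interface used from here on. *)
Lemma sqrtmxP m (M : 'M[R]_m) :
  psdmx M -> psdmx (sqrtmx M) /\ sqrtmx M *m sqrtmx M = M.
Proof.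
move=> /psdmx_sqrt_ex[Q HQ].
exact: (@xgetPex _ 0 [set Q : 'M[R]_m | psdmx Q /\ Q *m Q = M] (ex_intro _ Q HQ)).
Qed.

Lemma sqrtmx_unit m (M : 'M[R]_m) : pdmx M -> sqrtmx M \in unitmx.
Proof.
move=> Mpd; have [_ QQ] := sqrtmxP (pdmx_psdmx Mpd).
by have := pdmx_unit Mpd; rewrite -{1}QQ unitmx_mul andbb.
Qed.

End square_root.

(** * The covariance recursion *)

Section channel_gain.
Context {R : realType}.

Lemma qform_orthogonal_diag_ge m (Q : 'M[R]_m) (D : 'rV[R]_m) c u :
  orthogonalmx Q -> (forall j, c <= D 0 j) ->
  c * qform 1%:M u <= qform (Q *m diag_mx D *m Q^T) u.
Proof.
move=> Qo cD.
have QTo : orthogonalmx Q^T by rewrite /orthogonalmx trmxK; exact: mulmx1C.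
rewrite -{1}[Q]trmxK qform_congr -(qform1_orthogonal u QTo) qform1 qform_diag.
by rewrite mulr_sumr ler_sum// => j _; rewrite ler_wpM2r ?sqr_ge0.
Qed.

(** With y = X^-1 u, expand 0 <= |u - a y|^2 = |u|^2 - 2 a y^T X y + a^2 |y|^2 and bound a |y|^2 by
    y^T X y. This inverts the Loewner bound without diagonalizing [X]. *)
Lemma qform_invmx_le m (X : 'M[R]_m) a u :
  X^T = X -> X \in unitmx -> 0 < a ->
  (forall y, a * qform 1%:M y <= qform X y) ->
  a * qform (invmx X) u <= qform 1%:M u.
Proof.
move=> Xs Xu a0 Xa; set y := invmx X *m u.
have uE : u = X *m y by rewrite mulKVmx.
have E : qform (invmx X) u = (u^T *m y) 0 0 by rewrite /qform -mulmxA.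
have E' : qform X y = (u^T *m y) 0 0 by rewrite [in RHS]uE trmx_mul Xs.
have := qform1_ge0 (u - a *: y); rewrite qform1_expand E -E'.
have := Xa y; set t := qform 1%:M y; set s := qform X y; set w := qform _ u.
move=> ts h; suff : a ^+ 2 * t <= a * s by nra.
by rewrite expr2 -mulrA ler_pM2l.
Qed.

(* Completing the square: [z] is a trial value for [invmx V *m N *m u]. *)
Lemma qform_schur_ge m p (V : 'M[R]_m) (N : 'M[R]_(m, p)) u z :
  pdmx V ->
  2 * (z^T *m N *m u) 0 0 - qform V z <= qform (N^T *m invmx V *m N) u.
Proof.
move=> Vpd; have Vu := pdmx_unit Vpd; have Vs := Vpd.1.
set y := invmx V *m (N *m u).
have -> : qform (N^T *m invmx V *m N) u = qform V y.
  by rewrite qform_congr -(qform_congr V (invmx V)) trmx_inv_sym// mulVmx// mul1mx.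
have -> : (z^T *m N *m u) 0 0 = (z^T *m V *m y) 0 0.
  by rewrite -!mulmxA [V *m _]mulmxA mulmxV// mul1mx.
have subE (a b : 'M[R]_1) : (a - b) 0 0 = a 0 0 - b 0 0 by rewrite !mxE.
have := (pdmx_psdmx Vpd).2 (z - y).
rewrite /qform mulmxBr [(z - y)^T]raddfB /= !mulmxBl !subE.
have -> : (y^T *m V *m z) 0 0 = (z^T *m V *m y) 0 0.
  have -> : y^T *m V *m z = (z^T *m V *m y)^T by rewrite !trmx_mul trmxK Vs mulmxA.
  by rewrite mxE.
lra.
Qed.

(** The fraction [M_t] of the normalized error covariance that one transmission removes on the
    current block. *)
Definition channel_gain r (S W1 Psi : 'M[R]_r) : 'M[R]_r :=
  sqrtmx S *m Psi *m invmx (Psi *m S *m Psi + W1) *m Psi *m sqrtmx S.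

Lemma channel_gain_sym r (S W1 Psi : 'M[R]_r) :
  pdmx S -> pdmx W1 -> Psi^T = Psi ->
  (channel_gain S W1 Psi)^T = channel_gain S W1 Psi.
Proof.
move=> Spd W1pd Psis; have [[Qs _] _] := sqrtmxP (pdmx_psdmx Spd).
rewrite /channel_gain !trmx_mul trmx_inv_sym; first by rewrite Qs Psis !mulmxA.
by rewrite raddfD /= !trmx_mul Psis Spd.1 W1pd.1 mulmxA.
Qed.

(** Instead of inverting 1 + X^-1, a trial vector is inserted in the variational bound
    [qform_schur_ge], and X^-1 <= 1/a is used there as an inequality of quadratic forms. *)
Lemma channel_gain_ge r (S W1 Psi : 'M[R]_r) a :
  pdmx S -> pdmx W1 -> Psi^T = Psi -> Psi \in unitmx -> 0 < a ->
  (forall y, a * qform 1%:M y <=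
     qform (sqrtmx S *m (Psi *m invmx W1 *m Psi) *m sqrtmx S) y) ->
  forall u, a / (1 + a) * qform 1%:M u <= qform (channel_gain S W1 Psi) u.
Proof.
move=> Spd W1pd Psis Psiu a0 aX u; rewrite /channel_gain.
have [[Qs _] QQ] := sqrtmxP (pdmx_psdmx Spd); have Qu := sqrtmx_unit Spd.
move: aX Qs QQ Qu; set Q := sqrtmx S => aX Qs QQ Qu.
have W1u := pdmx_unit W1pd.
pose T := Q *m Psi; have Ts : T^T = Psi *m Q by rewrite trmx_mul Qs Psis.
have Tu : T \in unitmx by rewrite unitmx_mul Qu.
have TE : T = Q *m Psi by []; clearbody T.
pose X := Q *m (Psi *m invmx W1 *m Psi) *m Q.
have XE : X = T *m invmx W1 *m T^T by rewrite /X Ts TE !mulmxA.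
have Xu : X \in unitmx by rewrite XE !unitmx_mul unitmx_tr unitmx_inv Tu W1u.
move: aX XE Xu; rewrite -/X; move: X => X aX XE Xu.
have Xs : X^T = X.
  by rewrite XE !trmx_mul trmxK (trmx_inv_sym W1pd.1) mulmxA.
have Vpd : pdmx (Psi *m S *m Psi + W1).
  apply: pdmxD W1pd; rewrite -{1}Psis; apply: psdmx_congr; exact: pdmx_psdmx.
have VE : Psi *m S *m Psi = T^T *m T by rewrite Ts TE -QQ !mulmxA.
(* The maximizer is T^-1 (1 + X^-1)^-1 u; [z] is its value in the extremal case X = a. *)
set c := a / (1 + a); pose z := c *: (invmx T *m u).
have := qform_schur_ge T^T u z Vpd; rewrite trmxK -[z^T *m _ *m _]mulmxA.
have -> : T *m invmx (Psi *m S *m Psi + W1) *m T^T =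
   Q *m Psi *m invmx (Psi *m S *m Psi + W1) *m Psi *m Q by rewrite Ts TE !mulmxA.
apply: le_trans.
have -> : (z^T *m (T^T *m u)) 0 0 = c * qform 1%:M u.
  rewrite mulmxA -trmx_mul /z -scalemxAr mulKVmx// linearZ /= -scalemxAl mxE.
  by rewrite /qform mulmx1.
rewrite qformD VE /z.
have -> : qform (T^T *m T) (c *: (invmx T *m u)) = c ^+ 2 * qform 1%:M u.
  rewrite -[T^T]mulmx1 qform_congr -scalemxAr mulKVmx//.
  by rewrite !qform1 mulr_sumr; apply: eq_bigr => j _; rewrite mxE exprMn.
have -> : qform W1 (c *: (invmx T *m u)) = c ^+ 2 * qform (invmx X) u.
  have -> : c ^+ 2 * qform (invmx X) u = qform (invmx X) (c *: u).
    rewrite /qform -scalemxAr linearZ /= -!scalemxAl !mxE.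
    by rewrite mulrA -expr2.
  rewrite scalemxAr -qform_congr; congr (qform _ _).
  have XY : X *m ((invmx T)^T *m W1 *m invmx T) = 1%:M.
    by rewrite XE trmx_inv !mulmxA mulmxK ?unitmx_tr// mulmxKV// mulmxV.
  by rewrite -[LHS](mulKmx Xu) XY mulmx1.
have := qform_invmx_le u Xs Xu a0 aX.
set q := qform (invmx _) u; set w := qform _ u => aq.
have c0 : 0 < c by rewrite /c divr_gt0 ?addr_gt0.
have cE : c * (1 + a) = a by rewrite divfK// gt_eqF ?addr_gt0.
(* After multiplication by [a], the choice c (1 + a) = a leaves only c^2 (w - a q) as the gap. *)
rewrite -subr_ge0 -(pmulr_rge0 _ a0).
have -> : a * (2 * (c * w) - (c ^+ 2 * w + c ^+ 2 * q) - c * w) =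
    c ^+ 2 * (w - a * q) + c * w * (a - c * (1 + a)) by ring.
rewrite cE subrr mulr0 addr0; apply: mulr_ge0; last by rewrite subr_ge0.
by rewrite exprn_ge0 // ltW.
Qed.


(** Here X = S^(1/2) (Psi W1^-1 Psi) S^(1/2) >= pi S >= sigma pi, each bound being read off a
    spectral decomposition. *)
Lemma channel_gain_decomposition_ge r (S W1 Psi U : 'M[R]_r) (L Pi : 'rV[R]_r)
    sigma pi :
  pdmx S -> pdmx W1 -> Psi^T = Psi -> Psi \in unitmx -> orthogonalmx U ->
  S = U *m diag_mx L *m U^T -> Psi *m invmx W1 *m Psi = U *m diag_mx Pi *m U^T ->
  0 < sigma -> 0 < pi ->
  (forall j, sigma <= L 0 j) -> (forall j, pi <= Pi 0 j) ->
  forall u, sigma * pi / (1 + sigma * pi) * qform 1%:M u <=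
            qform (channel_gain S W1 Psi) u.
Proof.
move=> Spd W1pd Psis Psiu Uo SE NE s0 p0 sL pP.
apply: channel_gain_ge => //; first exact: mulr_gt0.
move=> y; rewrite NE; have [[Qs _] QQ] := sqrtmxP (pdmx_psdmx Spd).
have -> : forall N, qform (sqrtmx S *m N *m sqrtmx S) y = qform N (sqrtmx S *m y).
  by move=> N; rewrite -qform_congr Qs.
apply: le_trans (qform_orthogonal_diag_ge _ Uo pP).
rewrite -qform_congr Qs mulmx1 QQ [sigma * _]mulrC -mulrA ler_pM2l//.
by rewrite SE; exact: qform_orthogonal_diag_ge.
Qed.

(** The entry is the value of the quadratic form of [N] at the j-th column of [U]. It serves to make
    [pimin] positive. *)
Lemma spectral_entry_gt0 m (N U : 'M[R]_m) (Pi : 'rV[R]_m) j :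
  pdmx N -> orthogonalmx U -> N = U *m diag_mx Pi *m U^T -> 0 < Pi 0 j.
Proof.
move=> [_ Np] Uo NE; have dj : delta_mx j 0 != 0 :> 'cV[R]_m.
  apply/eqP => /matrixP/(_ j 0)/eqP.
  by rewrite !mxE !eqxx oner_eq0.
have : U *m delta_mx j 0 != 0 :> 'cV[R]_m.
  apply: contra_neq dj => /(congr1 (mulmx U^T)).
  by rewrite mulmxA Uo mul1mx mulmx0.
move/Np; rewrite -/(qform _ _) -qform_congr NE !mulmxA Uo mul1mx -mulmxA Uo mulmx1.
rewrite qform_diag (bigD1 j)//= big1 => [|i ij].
  by rewrite addr0 mxE !eqxx expr1n mulr1.
by rewrite mxE (negbTE ij) expr0n mulr0.
Qed.

End channel_gain.

(** * One step of the error covariance and one period of its trace *)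

Section error_covariance.
Context {R : realType}.

Lemma select_blockK r d0 k :
  (k.+1 * r <= d0)%N ->
  select_block r d0 k *m (select_block r d0 k)^T = 1%:M :> 'M[R]_r.
Proof.
move=> kd; apply/matrixP => i j; rewrite !mxE.
have ib (i' : 'I_r) : (k * r + i' < d0)%N.
  by apply: leq_trans kd; rewrite mulSn addnC ltn_add2r.
rewrite (bigD1 (Ordinal (ib i)))//= big1 => [|l li].
  rewrite !mxE /= eqxx mul1r addr0 eqn_add2l.
  by congr (_%:R); apply/eqP/eqP => [/val_inj|->].
rewrite !mxE (_ : (l : nat) == (k * r + i)%N = false) ?mul0r//.
by apply: contra_neqF li => /eqP li; exact: val_inj.
Qed.

(** Euclidean division of the coordinate [i] by [r] gives the only block (quotient) and the only row
    in it (remainder) that contribute. *)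
Lemma sum_select_block r tau :
  \sum_(k < tau) (select_block r (tau * r) k)^T *m select_block r (tau * r) k =
  1%:M :> 'M[R]_(tau * r).
Proof.
apply/matrixP => i j; rewrite summxE mxE.
have r0 : (0 < r)%N by case: r i {j} => [|//]; rewrite muln0 => -[].
have ir : (i %/ r < tau)%N by rewrite ltn_divLR// ltn_ord.
have im : (i %% r < r)%N by rewrite ltn_mod.
rewrite (bigD1 (Ordinal ir))//= big1 ?addr0 => [|k ki].
  rewrite mxE (bigD1 (Ordinal im))//= big1 ?addr0 => [|l li].
    by rewrite !mxE /= -divn_eq eqxx mul1r eq_sym.
  rewrite !mxE /= (_ : (i : nat) == _ = false) ?mul0r//.
  apply: contra_neqF li => /eqP li; apply: val_inj => /=.
  by rewrite li modnMDl modn_small.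
rewrite mxE big1// => l _; rewrite !mxE /= (_ : (i : nat) == _ = false) ?mul0r//.
apply: contra_neqF ki => /eqP li; apply: val_inj => /=.
by rewrite li divnMDl// divn_small ?addn0.
Qed.

(** [Sig'] is the Joseph form of a Kalman update with gain [L]. As a sum of two congruences it shows
    definiteness; the second form shows the decrease. They agree because [L] is the optimal gain:
    both cross terms and the quadratic term in [L] all equal the same [Z], so Sig - 2 Z + Z
    remains. *)
Lemma error_covariance_step d0 r (Sig : 'M[R]_d0) (S W1 Psi : 'M[R]_r)
    (P : 'M[R]_(r, d0)) :
  pdmx Sig -> pdmx S -> pdmx W1 -> Psi^T = Psi -> P *m P^T = 1%:M ->
  let H := sqrtmx Sig in
  let L := H *m P^T *m sqrtmx S *m Psi *m invmx (Psi *m S *m Psi + W1) in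
  let A := 1%:M - L *m Psi *m (sqrtmx S *m P *m invmx H) in
  let Sig' := A *m Sig *m A^T + L *m W1 *m L^T in
  pdmx Sig' /\ Sig' = Sig - H *m P^T *m channel_gain S W1 Psi *m P *m H.
Proof.
move=> Sigpd Spd W1pd Psis PP H L A Sig'.
have [[Hs _] HH] := sqrtmxP (pdmx_psdmx Sigpd); have Hu := sqrtmx_unit Sigpd.
have [[Qs _] QQ] := sqrtmxP (pdmx_psdmx Spd).
rewrite -/H in Hs HH Hu.
split.
  have E p q (N : 'M[R]_q) (B : 'M[R]_(p, q)) : B *m N *m B^T = (B^T)^T *m N *m B^T.
    by rewrite trmxK.
  split.
    by apply: (@psdmxD _ _ _ _ _ _).1; rewrite E; apply/psdmx_congr/pdmx_psdmx.
  move=> u u0; rewrite -/(qform _ _) /Sig' qformD !E !qform_congr.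
  (* If [L^T u] is nonzero the noise term is positive; otherwise [A^T u = u] and the first term is
     the positive form of [Sig]. *)
  have [Lu0|Lu0] := eqVneq (L^T *m u) 0; last first.
    by rewrite ltr_wpDl//; [apply: (pdmx_psdmx Sigpd).2|apply: W1pd.2].
  rewrite Lu0 ltr_wpDr//; first exact: (pdmx_psdmx W1pd).2.
  have -> : A^T *m u = u.
    rewrite /A raddfB /= trmx1 mulmxBl mul1mx -[L *m _ *m _]mulmxA.
    rewrite [in X in X *m u]trmx_mul.
    by rewrite -[X in _ - X]mulmxA Lu0 mulmx0 subr0.
  exact: Sigpd.2.
have Vpd : pdmx (Psi *m S *m Psi + W1).
  apply: pdmxD W1pd; rewrite -{1}Psis; apply: psdmx_congr; exact: pdmx_psdmx.
have Vu := pdmx_unit Vpd; have Vs := Vpd.1.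
pose Z := H *m P^T *m channel_gain S W1 Psi *m P *m H.
pose C := sqrtmx S *m P *m invmx H.
(* [C] maps the error to the transmitted signal, whose covariance is exactly [S]: Sig^(-1/2) whitens
   the error and the rows of [P] are orthonormal. *)
have CS : C *m Sig *m C^T = S.
  rewrite /C -HH !trmx_mul trmx_inv_sym// Qs !mulmxA mulmxKV// mulmxK//.
  by rewrite -[_ *m P *m _]mulmxA PP mulmx1.
have LCS : L *m Psi *m C *m Sig = Z.
  by rewrite /L /C /Z /channel_gain -HH !mulmxA mulmxKV.
have Zs : Z^T = Z.
  rewrite /Z /channel_gain !trmx_mul !trmxK trmx_inv_sym//.
  by rewrite Hs Qs Psis !mulmxA.
have LL : L *m (Psi *m S *m Psi + W1) *m L^T = Z.
  rewrite /L !trmx_mul !trmxK trmx_inv_sym// Hs Qs Psis mulmxKV//.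
  by rewrite /Z /channel_gain !mulmxA.
rewrite /Sig' /A -/C -/Z; move: L C CS LCS LL {A Sig'} => L C CS LCS LL.
set M := L *m Psi *m C.
have ZM : Sig *m M^T = Z by rewrite -Zs -LCS [in RHS]trmx_mul Sigpd.1.
rewrite raddfB /= trmx1 mulmxBl mul1mx LCS mulmxBr mulmx1 mulmxBl ZM.
have -> : Z *m M^T = L *m (Psi *m S *m Psi) *m L^T.
  by rewrite -LCS /M !trmx_mul Psis -CS !mulmxA.
have -> : Sig - Z - (Z - L *m (Psi *m S *m Psi) *m L^T) + L *m W1 *m L^T
   = Sig - Z - Z + (L *m (Psi *m S *m Psi) *m L^T + L *m W1 *m L^T).
  by rewrite opprB !addrA [_ + _ - Z]addrAC.
by rewrite -mulmxDl -mulmxDr LL subrK.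
Qed.

(** Both claims are congruences by B = P Sig^(1/2); cyclicity of the trace turns tr (B^T B) into tr
    (P Sig P^T). *)
Lemma error_covariance_decrease d0 r (Sig : 'M[R]_d0) (M : 'M[R]_r)
    (P : 'M[R]_(r, d0)) (delta : R) :
  pdmx Sig -> M^T = M -> 0 <= delta ->
  (forall u, delta * qform 1%:M u <= qform M u) ->
  let Z := sqrtmx Sig *m P^T *m M *m P *m sqrtmx Sig in
  psdmx Z /\ delta * \tr (P *m Sig *m P^T) <= \tr Z.
Proof.
move=> Sigpd Ms delta0 dM; have [[Hs _] HH] := sqrtmxP (pdmx_psdmx Sigpd).
set H := sqrtmx Sig in Hs HH *; set B := P *m H.
have ZE (N : 'M[R]_r) : H *m P^T *m N *m P *m H = B^T *m N *m B.
  by rewrite /B trmx_mul Hs !mulmxA.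
move=> Z; rewrite /Z !ZE; split.
  apply: psdmx_congr; split=> // u; apply: le_trans (dM u).
  by rewrite mulr_ge0 ?qform1_ge0.
have -> : delta * \tr (P *m Sig *m P^T) = \tr (B^T *m (delta *: 1%:M) *m B).
  rewrite -scalemxAr -scalemxAl mulmx1 mxtraceZ [in RHS]mxtrace_mulC.
  by rewrite /B trmx_mul Hs -HH !mulmxA.
rewrite -subr_ge0 -raddfB /= -mulmxBl -mulmxBr; apply/mxtrace_psdmx_ge0/psdmx_congr.
split; first by rewrite raddfB /= Ms linearZ /= trmx1.
by move=> u; rewrite -/(qform _ _) qformB qformZ subr_ge0.
Qed.

(** The block reductions refer to different covariances and do not add up directly. Replacing each
    [Sig k] by the smaller [Sig tau] lets them sum to delta tr (Sig tau), which joins the left-hand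
    side. *)
Lemma trace_contraction r tau (Sig : nat -> 'M[R]_(tau * r)) (delta : R) :
  0 <= delta ->
  (forall k, (k < tau)%N -> psdmx (Sig k - Sig k.+1)) ->
  (forall k, (k < tau)%N -> let P := select_block r (tau * r) k in
     \tr (Sig k.+1) <= \tr (Sig k) - delta * \tr (P *m Sig k *m P^T)) ->
  (1 + delta) * \tr (Sig tau) <= \tr (Sig 0%N).
Proof.
move=> delta0 Sdec Strace; pose P k : 'M[R]_(r, _) := select_block r (tau * r) k.
have Smono k : (k <= tau)%N -> psdmx (Sig k - Sig tau).
  (* Downward induction from [tau], with the index written [tau - j]; once [j] reaches [tau] the
     subtraction truncates to 0 and nothing changes. *)
  move=> kt; rewrite -(subKn kt); elim: (tau - k)%N => [|j IH].
    rewrite subn0 subrr; split; first by rewrite trmx0.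
    by move=> u; rewrite mulmx0 mul0mx mxE.
  have [jt|jt] := ltnP j tau; last first.
    by move: IH; rewrite (eqP jt) (eqP (leqW jt)).
  rewrite -[X in psdmx X](subrKA (Sig (tau - j)%N)); apply: psdmxD IH.
  have tj : (tau - j = (tau - j.+1).+1)%N by rewrite subnS prednK ?subn_gt0.
  rewrite [in X in _ - X]tj; apply: Sdec.
 by rewrite -tj leq_subr.
have step k : (k <= tau)%N ->
    \tr (Sig k) + delta * \sum_(j < k) \tr (P j *m Sig tau *m (P j)^T) <= \tr (Sig 0%N).
  elim: k => [_|k IH kt]; first by rewrite big_ord0 mulr0 addr0.
  rewrite big_ord_recr /=; apply: le_trans (IH (ltnW kt)).
  have := Strace k kt; rewrite -/(P k) mulrDr.
  suff : \tr (P k *m Sig tau *m (P k)^T) <= \tr (P k *m Sig k *m (P k)^T).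
    by move/(ler_wpM2l delta0) => ? /= ?; lra.
  rewrite -subr_ge0 -raddfB /= -mulmxBl -mulmxBr -{1}[P k]trmxK.
  by apply/mxtrace_psdmx_ge0/psdmx_congr/Smono/ltnW.
apply: le_trans (step tau (leqnn _)); rewrite mulrDl mul1r lerD2l.
rewrite ler_wpM2l//.
under eq_bigr do rewrite -mulmxA mxtrace_mulC -mulmxA.
by rewrite -raddf_sum /= -mulmx_sumr sum_select_block mulmx1.
Qed.

End error_covariance.

(** * Second moments of Gaussian vectors *)

Section normal_second_moment.
Context {R : realType}.
Context (s : R).
Context (s0 : 0 < s).
Let mu := @lebesgue_measure R.
Let p := normal_pdf 0 s.

Let pE x : p x = normal_peak s * expR (- x ^+ 2 / (s ^+ 2 *+ 2)).
Proof. by rewrite /p normal_pdfE ?gt_eqF// /normal_fun subr0. Qed.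

Let p_ge0 x : 0 <= p x. Proof. exact: normal_pdf_ge0. Qed.

Let cp : continuous p. Proof. by apply: continuous_normal_pdf; rewrite gt_eqF. Qed.

Let dp x : is_derive x (1 : R) p (- (x / s ^+ 2) * p x).
Proof.
rewrite (_ : p = (fun x => normal_peak s * expR (- x ^+ 2 / (s ^+ 2 *+ 2)))); last first.
  by apply/funext => y; exact: pE.
apply: is_derive_eq.
by rewrite /GRing.scale /=; field; rewrite gt_eqF.
Qed.

(** A primitive of x p is - s^2 p, so this is, up to sign, the boundary term when x (x p) is
    integrated by parts. *)
Let F x := s ^+ 2 * (x * p x).

Let dF x : is_derive x (1 : R) F (s ^+ 2 * p x - x ^+ 2 * p x).
Proof.
have dpx := dp x; rewrite /F; move: dpx; move: (p) => g dg.
apply: is_derive_eq.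
by rewrite /GRing.scale /=; field; rewrite gt_eqF.
Qed.

Let cF : continuous F.
Proof.
move=> x; apply: differentiable_continuous; apply/derivable1_diffP.
by case: (dF x).
Qed.

(** With y = x^2 / (2 s^2), the crude bound exp (- y) <= 1 / y already makes [F] of order 1 / x,
    with the constant 2 s^4 [normal_peak s]. *)
Let cvgF : F x @[x --> +oo] --> (0 : R).
Proof.
apply: (@squeeze_cvgr _ _ _ _ (cst 0) (fun x => normal_peak s * (s ^+ 4 *+ 2) * x^-1)).
- near=> x; have x0 : 0 < x.
    by near: x; apply: nbhs_pinfty_gt; exact: num_real.
  apply/andP; split; first by rewrite /= /F mulr_ge0 ?sqr_ge0// mulr_ge0// ltW.
  rewrite /F pE; set y := x ^+ 2 / (s ^+ 2 *+ 2).
  have y0 : 0 < y by rewrite /y divr_gt0 ?mulrn_wgt0 ?exprn_gt0.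
  have : expR (- y) <= y^-1.
    rewrite expRN lef_pV2 ?posrE ?expR_gt0//.
    by apply: le_trans (expR_ge1Dx y); rewrite ler_wpDl.
  move=> ey.
  have -> : normal_peak s * (s ^+ 4 *+ 2) / x = s ^+ 2 * (x * (normal_peak s * y^-1)).
    by rewrite /y; field; rewrite !gt_eqF.
  apply: ler_wpM2l; first exact: sqr_ge0.
  apply: ler_wpM2l; first exact: ltW.
  rewrite mulNr -/y; apply: ler_wpM2l ey; exact: normal_peak_ge0.
- exact: cvg_cst.
- rewrite -[X in _ --> X](mulr0 (normal_peak s * (s ^+ 4 *+ 2))).
  apply: cvgM; first exact: cvg_cst.
  apply/(gtr0_cvgV0 (f := id)); last exact: cvg_id.
  by apply: nbhs_pinfty_gt; exact: num_real.
Unshelve. all: end_near. Qed.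

Let mp : measurable_fun setT p. Proof. exact: measurable_normal_pdf. Qed.

Let integral_le_s :
  (\int[mu]_(x in `[0%R, s]) ((s ^+ 2 - x ^+ 2) * p x)%:E = (F s)%:E)%E.
Proof.
rewrite (@continuous_FTC2 _ _ F)//.
- by rewrite /F mul0r mulr0 sube0.
- apply: continuous_subspaceT => x; apply: cvgM; last exact: cp.
  by apply: cvgB; [exact: cvg_cst|exact: exprn_continuous].
- split=> [x _| |]; first by case: (dF x).
  + by apply: cvg_at_right_filter; exact: cF.
  + by apply: cvg_at_left_filter; exact: cF.
- by move=> x _; rewrite derive1E mulrBl; have [_ ->] := dF x.
Qed.

Let integral_ge_s :
  (\int[mu]_(x in `[s, +oo[) ((x ^+ 2 - s ^+ 2) * p x)%:E = (F s)%:E)%E.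
Proof.
rewrite (@ge0_continuous_FTC2y _ _ (fun x => - F x) _ 0).
- by rewrite -EFinB opprK add0r.
- move=> x sx; have x0 := le_trans (ltW s0) sx.
  by rewrite mulr_ge0// subr_ge0 lerXn2r// nnegrE ltW.
- apply: continuous_subspaceT => x; apply: cvgM; last exact: cp.
  by apply: cvgB; [exact: exprn_continuous|exact: cvg_cst].
- by rewrite -[X in _ --> X]oppr0; apply: cvgN.
- by move=> x _; apply: derivableN; case: (dF x).
- by apply: cvgN; apply: cvg_at_right_filter; exact: cF.
- move=> x _; rewrite derive1E deriveN; last by case: (dF x).
  by have [_ ->] := dF x; rewrite opprB mulrBl.
Qed.

Let mq : measurable_fun setT (fun x : R => x ^+ 2 * p x).
Proof. by apply: measurable_funM => //; exact: measurable_funX. Qed.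

Let mc : measurable_fun setT (fun x : R => s ^+ 2 * p x).
Proof. exact: measurable_funM. Qed.

(* (x^2 - s^2) p is the derivative of - s^2 x p; it is split at s, where it
   changes sign, so that only integrals of nonnegative functions occur. *)
Let half_second_moment :
  (\int[mu]_(x in [set x : R | (0 <= x)%R]) (x ^+ 2 * p x)%:E =
   \int[mu]_(x in [set x : R | (0 <= x)%R]) (s ^+ 2 * p x)%:E)%E.
Proof.
have -> : [set x : R | 0 <= x] = `[0, s[ `|` `[s, +oo[.
  apply/seteqP; split => x /=; rewrite !in_itv/= ?andbT.
    by move=> x0; case: (ltP x s) => xs; [left|right]; rewrite ?x0.
  by case=> [/andP[]//|]; apply: le_trans; exact: ltW.
have dis : [disjoint `[0, s[ & `[s, +oo[].
  apply/disj_set2P; rewrite -subset0 => x /=; rewrite !in_itv/= => -[/andP[_]].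
  by rewrite ltNge => /negP xs; rewrite andbT.
have ge0q (x : R) : (0 <= (x ^+ 2 * p x)%:E)%E by rewrite lee_fin mulr_ge0 ?sqr_ge0.
have ge0c (x : R) : (0 <= (s ^+ 2 * p x)%:E)%E by rewrite lee_fin mulr_ge0 ?sqr_ge0.
rewrite !ge0_integral_setU//=; try exact/measurable_EFinP/measurable_funTS.
rewrite !integral_itv_bndo_bndc; try exact/measurable_EFinP/measurable_funTS.
have -> : (\int[mu]_(x in `[0%R, s]) (s ^+ 2 * p x)%:E =
    \int[mu]_(x in `[0%R, s]) (x ^+ 2 * p x)%:E + (F s)%:E)%E.
  rewrite -integral_le_s -ge0_integralD//=.
  - by apply: eq_integral => x _; rewrite -EFinD -mulrDl addrC subrK.
  - exact/measurable_EFinP/measurable_funTS.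
  - move=> x; rewrite in_itv/= => /andP[x0 xs].
    by rewrite lee_fin mulr_ge0// subr_ge0 lerXn2r// nnegrE ltW.
  - apply/measurable_EFinP/measurable_funTS/measurable_funM => //.
    by apply: measurable_funB => //; exact: measurable_funX.
have -> : (\int[mu]_(x in `[s, +oo[) (x ^+ 2 * p x)%:E =
    (F s)%:E + \int[mu]_(x in `[s, +oo[) (s ^+ 2 * p x)%:E)%E.
  rewrite -integral_ge_s -ge0_integralD//=.
  - by apply: eq_integral => x _; rewrite -EFinD -mulrDl subrK.
  - move=> x; rewrite in_itv/= andbT => sx; have x0 := le_trans (ltW s0) sx.
    by rewrite lee_fin mulr_ge0// subr_ge0 lerXn2r// nnegrE ltW.
  - apply/measurable_EFinP/measurable_funTS/measurable_funM => //.
    by apply: measurable_funB => //; exact: measurable_funX.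
  - exact/measurable_EFinP/measurable_funTS.
by rewrite addeA.
Qed.

Let p_even x : p (- x) = p x. Proof. by rewrite !pE sqrrN. Qed.

Lemma integral_normal_pdf_sqr :
  (\int[mu]_x (x ^+ 2 * p x)%:E = (s ^+ 2)%:E)%E.
Proof.
rewrite ge0_symfun_integralT; last 3 first.
- by move=> x; rewrite mulr_ge0 ?sqr_ge0.
- by move=> x; apply: cvgM; [exact: exprn_continuous|exact: cp].
- by move=> x /=; rewrite sqrrN p_even.
rewrite half_second_moment -ge0_symfun_integralT; last 3 first.
- by move=> x; rewrite mulr_ge0 ?sqr_ge0.
- by move=> x; apply: cvgM; [exact: cvg_cst|exact: cp].
- by move=> x /=; rewrite p_even.
under eq_integral do rewrite EFinM.
rewrite ge0_integralZl//=; last 3 first.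
- exact/measurable_EFinP.
- by move=> x _; rewrite lee_fin.
- by rewrite lee_fin sqr_ge0.
by rewrite integral_normal_pdf mule1.
Qed.

(** The Radon-Nikodym derivative of [normal_prob] agrees almost everywhere with the density, since
    both integrate to the measure of every measurable set. *)
Lemma normal_prob_second_moment :
  (\int[normal_prob 0 s]_x (x ^+ 2)%:E = (s ^+ 2)%:E)%E.
Proof.
rewrite -integral_normal_pdf_sqr.
rewrite -(Radon_Nikodym_SigmaFinite.change_of_variables (normal_prob_dominates 0 s))//=.
- apply: ae_eq_integral => //.
  + apply: emeasurable_funM; first exact/measurable_EFinP/measurable_funX.
    apply: (measurable_int mu); apply: Radon_Nikodym_SigmaFinite.f_integrable.
    exact: normal_prob_dominates.
  + exact/measurable_EFinP.
  under [X in ae_eq _ _ _ X]eq_fun do rewrite EFinM.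
  apply: ae_eqe_mul2l => /=; apply: integral_ae_eq => //=.
  + apply: Radon_Nikodym_SigmaFinite.f_integrable; exact: normal_prob_dominates.
  + exact/measurable_EFinP.
  + move=> E _ mE; rewrite -Radon_Nikodym_SigmaFinite.f_integral//.
    exact: normal_prob_dominates.
- by move=> x; rewrite lee_fin sqr_ge0.
- exact/measurable_EFinP/measurable_funX.
Qed.

End normal_second_moment.

(** * Moments of scalar normal variables *)

Section scalar_moments.
Context d (T : measurableType d) (R : realType) (P : probability T R).
Implicit Types X Y : T -> R.

Lemma Lfun2_sqr_integral X v :
  measurable_fun setT X -> (\int[P]_om (X om ^+ 2)%:E = v%:E)%E ->
  X \in Lfun P 2%:E.
Proof.
move=> mX X2; rewrite inE/=; apply/andP; split; rewrite inE//=.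
rewrite /finite_norm unlock poweR_lty//.
under eq_integral => om _ do rewrite /= powR_mulrn// real_normK ?num_real//.
by rewrite X2 ltry.
Qed.

Lemma Lfun2_Lfun1 X : X \in Lfun P 2%:E -> X \in Lfun P 1.
Proof. by apply: Lfun_subset12; rewrite fin_num_measure. Qed.

Lemma Lfun2_measurable X : X \in Lfun P 2%:E -> measurable_fun setT X.
Proof. by rewrite inE => /andP[/[!inE]]. Qed.

Lemma centered_normal_sqr X v : 0 <= v -> centered_normal P X v ->
  (\int[P]_om (X om ^+ 2)%:E = v%:E)%E.
Proof.
move=> v0 [mX XP].
pose X' : {mfun T >-> measurableTypeR R} :=
  HB.pack X (isMeasurableFun.Build _ _ _ (measurableTypeR R) X mX).
have -> : (\int[P]_om (X om ^+ 2)%:E = \int[distribution P X']_y (y ^+ 2)%:E)%E.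
  rewrite ge0_integral_distribution//=.
  - exact/measurable_EFinP/measurable_funX.
  - by move=> y; rewrite lee_fin sqr_ge0.
move: XP; have [->|vn0] := eqVneq v 0 => XP.
  rewrite (@eq_measure_integral _ _ _ _ (\d_(0 : measurableTypeR R)))//.
    rewrite integral_dirac//= ?diracT ?mul1e ?expr0n//.
    exact/measurable_EFinP/measurable_funX.
  by move=> A mA _; exact: XP.
have sv : 0 < Num.sqrt v by rewrite sqrtr_gt0 lt_def vn0.
rewrite -[in RHS](sqr_sqrtr v0) -(normal_prob_second_moment sv).
apply: (@eq_measure_integral _ _ _ _ (normal_prob 0 (Num.sqrt v)) (distribution P X')).
by move=> A mA _; exact: XP.
Qed.

Lemma expectationN X : X \in Lfun P 1 -> ('E_P[\- X] = - 'E_P[X])%E.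
Proof.
move=> X1; have -> : (\- X = -1 \o* X) by apply/funext => om /=; rewrite mulrN1.
by rewrite expectationZl// mulN1e.
Qed.

Lemma eq_opp_fin_num_eq0 (x : \bar R) : x \is a fin_num -> (x = - x)%E -> x = 0%E.
Proof.
by case: x => // r _ [rr]; congr EFin; lra.
Qed.

(** [X] and its opposite have one law, so the mean, being finite and equal to its own opposite,
    vanishes. *)
Lemma sym_law_expectation X v : X \in Lfun P 1 ->
  centered_normal P X v -> centered_normal P (\- X) v -> ('E_P[X] = 0)%E.
Proof.
move=> X1 [mX XP] [mNX NXP]; apply: eq_opp_fin_num_eq0.
  exact: expectation_fin_num.
have NX1 : \- X \in Lfun P 1 by rewrite rpredN.
rewrite -expectationN// unlock.
have E (Y : T -> R) : measurable_fun setT Y -> Y \in Lfun P 1 ->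
    (\int[P]_om (Y om)%:E = \int[pushforward P Y]_y y%:E)%E.
  move=> mY Y1; rewrite integral_pushforward//.
  exact/Lfun1_integrable.
pose X' : {mfun T >-> R} := HB.pack X (isMeasurableFun.Build _ _ _ _ X mX).
pose NX' : {mfun T >-> R} :=
  HB.pack (\- X) (isMeasurableFun.Build _ _ _ _ (\- X) mNX).
rewrite !E//.
apply: (@eq_measure_integral _ _ _ _ (distribution P NX') (distribution P X')).
by move=> A mA _; rewrite /= /distribution /pushforward XP// NXP.
Qed.

(* (X, Y) and (- X, Y) have the same law. *)
Lemma independent_symmetric_expectationM X Y :
  X \in Lfun P 2%:E -> Y \in Lfun P 2%:E ->
  (forall B, measurable B -> P (X @^-1` B) = P ((\- X) @^-1` B)) ->
  (forall A B, measurable A -> measurable B ->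
     P (X @^-1` A `&` Y @^-1` B) = P (X @^-1` A) * P (Y @^-1` B))%E ->
  ('E_P[X * Y] = 0)%E.
Proof.
move=> X2 Y2 symX indXY.
have mX := Lfun2_measurable X2; have mY := Lfun2_measurable Y2.
have NX2 : \- X \in Lfun P 2%:E by rewrite rpredN// lee1n.
have mNX := Lfun2_measurable NX2.
apply: eq_opp_fin_num_eq0.
  by apply: expectation_fin_num; exact: Lfun2_mul_Lfun1.
have XY1 : X * Y \in Lfun P 1 by exact: Lfun2_mul_Lfun1.
rewrite -expectationN// (_ : \- (X * Y) = (\- X) * Y); last first.
  by apply/funext => om; rewrite /= mulNr.
pose X' : {mfun T >-> R} := HB.pack X (isMeasurableFun.Build _ _ _ _ X mX).
pose Y' : {mfun T >-> R} := HB.pack Y (isMeasurableFun.Build _ _ _ _ Y mY).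
pose Z (X : T -> R) om := (X om, Y om).
have mZ (X0 : T -> R) : measurable_fun setT X0 -> measurable_fun setT (Z X0).
  by move=> mX0; exact: measurable_fun_pair.
pose Z1 : {mfun T >-> (R * R)%type} :=
  HB.pack (Z X) (isMeasurableFun.Build _ _ _ _ (Z X) (mZ _ mX)).
pose Z2 : {mfun T >-> (R * R)%type} := HB.pack (Z (\- X))
  (isMeasurableFun.Build _ _ _ _ (Z (\- X)) (mZ _ mNX)).
rewrite unlock.
have E (X0 : T -> R) : X0 \in Lfun P 2%:E ->
    (\int[P]_om ((X0 * Y) om)%:E = \int[pushforward P (Z X0)]_z (z.1 * z.2)%:E)%E.
  move=> X02; rewrite integral_pushforward//.
  - exact/mZ/Lfun2_measurable.
  - by apply/measurable_EFinP/measurable_funM.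
  - exact/Lfun1_integrable/Lfun2_mul_Lfun1.
rewrite !E//.
apply: (@eq_measure_integral _ _ _ _ (distribution P Z2) (distribution P Z1)).
(* Both joint laws are identified with the product of the laws of [X] and [Y], which is determined
   by its values on rectangles. *)
move=> A mA _; transitivity ((distribution P X' \x distribution P Y')%E A).
  apply/esym; apply: product_measure_unique mA => B C mB mC.
  by rewrite -indXY.
apply: product_measure_unique mA => B C mB mC.
have NB : measurable (-%R @^-1` B : set R).
  by rewrite -[X in measurable X]setTI; exact: (oppr_measurable measurableT).
rewrite [LHS](_ : _ = P (X @^-1` (-%R @^-1` B) `&` Y @^-1` C))//.
rewrite indXY//; congr (_ * _)%E.
by rewrite [RHS]symX.
Qed.

End scalar_moments.

(** * Bilinear calculus of cross-covariances *)

Section cross_covariance.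
Context d (T : measurableType d) (R : realType) (P : probability T R).

(** Under this condition all covariances are finite, so [fine] loses nothing. *)
Definition square_integrable m (X : T -> 'cV[R]_m) :=
  forall i, (fun om => X om i 0) \in Lfun P 2%:E.

(** [crosscov X X] is convertible with [covmx P X]; two separate arguments make bilinearity
    expressible. *)
Definition crosscov m p (X : T -> 'cV[R]_m) (Y : T -> 'cV[R]_p) :
    'M[R]_(m, p) :=
  \matrix_(i, j)
    fine (covariance P (fun om => X om i 0) (fun om => Y om j 0)).

Lemma Lfun2D (X Y : T -> R) : X \in Lfun P 2%:E -> Y \in Lfun P 2%:E ->
  (fun om => X om + Y om) \in Lfun P 2%:E.
Proof. by move=> X2 Y2; rewrite -[fun _ => _]/(X \+ Y) rpredD ?lee1n. Qed.

Lemma Lfun2Z a (X : T -> R) : X \in Lfun P 2%:E ->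
  (fun om => a * X om) \in Lfun P 2%:E.
Proof.
by move=> X2; under eq_fun do rewrite mulrC; apply: Lfun_scale; rewrite ?ler1n.
Qed.

Lemma Lfun2_lincomb (I : Type) (s : seq I) (a : I -> R) (f : I -> T -> R) :
  (forall i, f i \in Lfun P 2%:E) ->
  (fun om => \sum_(i <- s) a i * f i om) \in Lfun P 2%:E.
Proof.
move=> f2; elim: s => [|i s IH].
  under eq_fun do rewrite big_nil; exact: Lfun_cst.
under eq_fun do rewrite big_cons.
by apply: Lfun2D IH; exact: Lfun2Z.
Qed.

Lemma fine_covarianceD (X Y Z : T -> R) :
  X \in Lfun P 2%:E -> Y \in Lfun P 2%:E -> Z \in Lfun P 2%:E ->
  fine (covariance P (fun om => X om + Y om) Z) =
  fine (covariance P X Z) + fine (covariance P Y Z).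
Proof.
move=> X2 Y2 Z2; rewrite covarianceDl// fineD// covariance_fin_num//;
  by [exact: Lfun2_Lfun1 | exact: Lfun2_mul_Lfun1].
Qed.

Lemma fine_covarianceZ a (X Z : T -> R) :
  X \in Lfun P 2%:E -> Z \in Lfun P 2%:E ->
  fine (covariance P (fun om => a * X om) Z) = a * fine (covariance P X Z).
Proof.
move=> X2 Z2; have X1 := Lfun2_Lfun1 X2; have Z1 := Lfun2_Lfun1 Z2.
have XZ1 := Lfun2_mul_Lfun1 X2 Z2.
under eq_fun do rewrite mulrC.
by rewrite covarianceZl// fineM// covariance_fin_num.
Qed.

Lemma fine_covariance_lincomb (I : Type) (s : seq I) (a : I -> R)
    (f : I -> T -> R) Z :
  (forall i, f i \in Lfun P 2%:E) -> Z \in Lfun P 2%:E ->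
  fine (covariance P (fun om => \sum_(i <- s) a i * f i om) Z) =
  \sum_(i <- s) a i * fine (covariance P (f i) Z).
Proof.
move=> f2 Z2; elim: s => [|i s IH].
  under eq_fun do rewrite big_nil.
  by rewrite big_nil -[fun _ => 0]/(cst 0) covariance_cst_l.
under eq_fun do rewrite big_cons.
rewrite big_cons -IH -fine_covarianceZ// fine_covarianceD//.
- exact: Lfun2Z.
- exact: Lfun2_lincomb.
Qed.

Lemma square_integrable_mul m p (A : 'M[R]_(p, m)) (X : T -> 'cV[R]_m) :
  square_integrable X -> square_integrable (fun om => A *m X om).
Proof. by move=> X2 i; under eq_fun do rewrite mxE; exact: Lfun2_lincomb. Qed.

Lemma square_integrableD m (X Y : T -> 'cV[R]_m) :
  square_integrable X -> square_integrable Y ->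
  square_integrable (fun om => X om + Y om).
Proof.
move=> X2 Y2 i; under eq_fun do rewrite mxE.
by apply: Lfun2D; [exact: X2|exact: Y2].
Qed.

Lemma trmx_crosscov m p (X : T -> 'cV[R]_m) (Y : T -> 'cV[R]_p) :
  (crosscov X Y)^T = crosscov Y X.
Proof. by apply/matrixP => i j; rewrite !mxE covarianceC. Qed.

Lemma crosscov_mull m p q (A : 'M[R]_(q, m)) (X : T -> 'cV[R]_m)
    (Y : T -> 'cV[R]_p) :
  square_integrable X -> square_integrable Y ->
  crosscov (fun om => A *m X om) Y = A *m crosscov X Y.
Proof.
move=> X2 Y2; apply/matrixP => i j; rewrite !mxE.
under eq_fun do rewrite mxE.
rewrite fine_covariance_lincomb//; apply: eq_bigr => k _.
by rewrite mxE.
Qed.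

Lemma crosscovDl m p (X X' : T -> 'cV[R]_m) (Y : T -> 'cV[R]_p) :
  square_integrable X -> square_integrable X' -> square_integrable Y ->
  crosscov (fun om => X om + X' om) Y = crosscov X Y + crosscov X' Y.
Proof.
move=> X2 X'2 Y2; apply/matrixP => i j; rewrite !mxE.
under eq_fun do rewrite mxE.
by rewrite fine_covarianceD.
Qed.

Lemma crosscov_mulr m p q (A : 'M[R]_(q, p)) (X : T -> 'cV[R]_m)
    (Y : T -> 'cV[R]_p) :
  square_integrable X -> square_integrable Y ->
  crosscov X (fun om => A *m Y om) = crosscov X Y *m A^T.
Proof.
by move=> X2 Y2; rewrite -trmx_crosscov crosscov_mull// trmx_mul trmx_crosscov.
Qed.

Lemma crosscovDr m p (X : T -> 'cV[R]_m) (Y Y' : T -> 'cV[R]_p) :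
  square_integrable X -> square_integrable Y -> square_integrable Y' ->
  crosscov X (fun om => Y om + Y' om) = crosscov X Y + crosscov X Y'.
Proof.
by move=> *; rewrite -trmx_crosscov crosscovDl// raddfD /= !trmx_crosscov.
Qed.

Lemma covmx_uncorrelated m p q (A : 'M[R]_(q, m)) (B : 'M[R]_(q, p))
    (X : T -> 'cV[R]_m) (Y : T -> 'cV[R]_p) :
  square_integrable X -> square_integrable Y -> crosscov X Y = 0 ->
  covmx P (fun om => A *m X om + B *m Y om) =
  A *m covmx P X *m A^T + B *m covmx P Y *m B^T.
Proof.
move=> X2 Y2 XY0.
have AX2 := square_integrable_mul A X2; have BY2 := square_integrable_mul B Y2.
have ABXY2 := square_integrableD AX2 BY2.
have YX0 : crosscov Y X = 0 by rewrite -trmx_crosscov XY0 trmx0.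
rewrite -[LHS]/(crosscov _ _) crosscovDl// !crosscovDr// !crosscov_mull//.
rewrite !crosscov_mulr// XY0 YX0 !mul0mx !mulmx0 addr0 add0r.
by rewrite -!mulmxA.
Qed.

(** The linear forms along a basis vector and its opposite have the same variance, which yields the
    symmetry of each component. *)
Lemma gaussian_component m (X : T -> 'cV[R]_m) M i : gaussian_vector P X M ->
  centered_normal P (fun om => X om i 0) (M i i) /\
  centered_normal P (\- (fun om => X om i 0)) (M i i).
Proof.
move=> XM; split.
  have := XM (delta_mx i 0).
  under [X in centered_normal _ X]eq_fun do rewrite trmx_delta -rowE mxE.
  by rewrite trmx_delta -rowE -colE !mxE.
have := XM (- delta_mx i 0).
under [X in centered_normal _ X]eq_fun do rewrite raddfN /= mulNmx trmx_delta -rowE !mxE.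
by rewrite mulmxN raddfN /= !mulNmx opprK trmx_delta -rowE -colE !mxE.
Qed.

Lemma gaussian_square_integrable m (X : T -> 'cV[R]_m) M :
  psdmx M -> gaussian_vector P X M -> square_integrable X.
Proof.
move=> Mpsd XM i; have [Xi _] := gaussian_component i XM.
apply: Lfun2_sqr_integral (centered_normal_sqr _ Xi); first by case: Xi.
by have := Mpsd.2 (delta_mx i 0); rewrite trmx_delta -rowE -colE !mxE.
Qed.

Lemma gaussian_expectation m (X : T -> 'cV[R]_m) M i :
  psdmx M -> gaussian_vector P X M -> ('E_P[fun om => X om i 0%R] = 0)%E.
Proof.
move=> Mpsd XM; have [Xi NXi] := gaussian_component i XM.
apply: sym_law_expectation Xi NXi.
exact/Lfun2_Lfun1/(gaussian_square_integrable Mpsd XM).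
Qed.

(** Polarization at the basis vectors and at their pairwise sums. *)
Lemma sym_qform_inj m (M N : 'M[R]_m) :
  M^T = M -> N^T = N -> (forall u, qform M u = qform N u) -> M = N.
Proof.
move=> Ms Ns MN; apply/matrixP => i j.
have E (K : 'M[R]_m) : K^T = K ->
    qform K (delta_mx i 0 + delta_mx j 0) = K i i + K j j + K i j *+ 2.
  move=> Ks; rewrite /qform mulmxDr [(_ + _)^T]raddfD /= !trmx_delta !mulmxDl.
  have Kji : K j i = K i j by rewrite -{1}Ks mxE.
  by rewrite -!rowE -!colE !mxE Kji; ring.
have D (K : 'M[R]_m) k : qform K (delta_mx k 0) = K k k.
  by rewrite /qform trmx_delta -rowE -colE !mxE.
have := MN (delta_mx i 0 + delta_mx j 0).
rewrite !E// -[M i i]D -[M j j]D !MN !D => /addrI/eqP.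
by rewrite -subr_eq0 -mulrnBl mulrn_eq0 subr_eq0 => /eqP.
Qed.

(** [gaussian_vector] prescribes only variances of linear forms; polarization recovers the
    off-diagonal entries. *)
Lemma gaussian_covmx m (X : T -> 'cV[R]_m) M :
  psdmx M -> gaussian_vector P X M -> covmx P X = M.
Proof.
move=> Mpsd XM; have X2 := gaussian_square_integrable Mpsd XM.
apply: sym_qform_inj Mpsd.1 _ => [|u]; first exact: trmx_crosscov.
pose Z om := (u^T *m X om) 0 0.
have NZ : centered_normal P (\- Z) (qform M u).
  have := XM (- u); rewrite mulmxN raddfN /= !mulNmx opprK.
  by under [X in centered_normal _ X]eq_fun do rewrite mulNmx mxE.
have uX2 := square_integrable_mul u^T X2.
have -> : qform (covmx P X) u =
    crosscov (fun om => u^T *m X om) (fun om => u^T *m X om) 0 0.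
  by rewrite crosscov_mull// crosscov_mulr// trmxK mulmxA.
have Z2 : Z \in Lfun P 2%:E := uX2 0.
rewrite mxE -/Z -[covariance P Z Z]/(variance P Z) varianceE//.
rewrite (sym_law_expectation (Lfun2_Lfun1 Z2) (XM u) NZ) unlock.
rewrite (_ : (\int[P]_om _)%E = (\int[P]_om (Z om ^+ 2)%:E)%E)//.
by rewrite (centered_normal_sqr (Mpsd.2 u) (XM u)) expe2 mule0 sube0.
Qed.

Lemma mutually_independent2 m (Z : nat -> T -> 'cV[R]_m) i j :
  mutually_independent P Z -> i != j ->
  forall A B, sigma_rv (Z i) A -> sigma_rv (Z j) B ->
  P (A `&` B) = (P A * P B)%E.
Proof.
move=> indZ ij A B ZA ZB.
have ji : (j == i) = false by rewrite eq_sym (negbTE ij).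
have := indZ [:: i; j] (fun k => if k == i then A else B).
rewrite /= inE ij => /(_ isT); rewrite !big_cons big_nil eqxx ji mule1 => <-.
  congr (P _); apply/seteqP; split => [om [Aom Bom] k|om kom].
    by rewrite /= !inE => /orP[]/eqP ->; rewrite ?eqxx// ji.
  split; first by have := kom i; rewrite /= inE eqxx; apply.
  by have := kom j; rewrite /= !inE eqxx orbT ji; apply.
by move=> k; rewrite !inE => /orP[]/eqP ->; rewrite ?eqxx// ji.
Qed.

(** The means vanish, so each covariance is a mixed moment, which is zero by the symmetry of [X]. *)
Lemma gaussian_independent_crosscov m (X Y : T -> 'cV[R]_m) M N :
  psdmx M -> psdmx N -> gaussian_vector P X M -> gaussian_vector P Y N ->
  (forall A B, sigma_rv X A -> sigma_rv Y B -> P (A `&` B) = (P A * P B)%E) ->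
  crosscov X Y = 0.
Proof.
move=> Mpsd Npsd XM YN indXY; apply/matrixP => i j; rewrite !mxE.
have X2 := gaussian_square_integrable Mpsd XM i.
have Y2 := gaussian_square_integrable Npsd YN j.
rewrite covarianceE ?(gaussian_expectation i Mpsd XM) ?mul0e ?sube0; last 3 first.
- exact: Lfun2_Lfun1.
- exact: Lfun2_Lfun1.
- exact: Lfun2_mul_Lfun1.
have [[_ lX] [_ lNX]] := gaussian_component i XM.
rewrite independent_symmetric_expectationM// => [B mB|A B mA mB].
  by rewrite lX// lNX.
by apply: indXY; apply: sub_sigma_algebra; [exists i, A|exists j, B].
Qed.

End cross_covariance.

(** * The closed loop *)

Lemma pid_mxK (R : realType) r d : (r <= d)%N ->
  (pid_mx r : 'M[R]_(r, d)) *m (pid_mx r : 'M[R]_(d, r)) = 1%:M.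
Proof. by move=> rd; rewrite pid_mx_id// pid_mx_1. Qed.

Lemma pid_mxKl (R : realType) r d p (X : 'M[R]_(r, p)) : (r <= d)%N ->
  (pid_mx r : 'M[R]_(r, d)) *m ((pid_mx r : 'M[R]_(d, r)) *m X) = X.
Proof. by move=> rd; rewrite mulmxA pid_mxK// mul1mx. Qed.

Lemma Wbar1_pdmx (R : realType) d0 r (Gamma0 W : 'M[R]_d0) : (r <= d0)%N ->
  orthogonalmx Gamma0 -> pdmx W -> pdmx (Wbar1 r Gamma0 W).
Proof.
move=> rd Go Wpd.
have -> : Wbar1 r Gamma0 W =
    (Gamma0 *m pid_mx r)^T *m W *m (Gamma0 *m pid_mx r).
  by rewrite /Wbar1 trmx_mul tr_pid_mx !mulmxA.
apply: (@pdmx_congr _ _ _ _ _ ((pid_mx r : 'M[R]_(r, d0)) *m Gamma0^T)) Wpd.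
by rewrite mulmxA -[_ *m Gamma0^T *m _]mulmxA Go mulmx1 pid_mxK.
Qed.

Section closed_loop.
Context d (T : measurableType d) (R : realType) (P : probability T R).
Context (n d0 d1 d2 r tau : nat).
Context (A : 'M[R]_d0) (B1 : 'M[R]_(d0, d1)) (B2 : 'M[R]_(d0, d2)) (W : 'M[R]_d0).
Context (K D : nat -> 'M[R]_(d1 + d2, d0)).
Context (Gamma0 : 'M[R]_d0) (Gamma1 : 'M[R]_d1) (psi : 'rV[R]_r) (U1 : 'M[R]_r)
  (Pi1 : 'rV[R]_r) (S : nat -> 'M[R]_r).
Context (x0 xs : T -> 'cV[R]_d0) (w : nat -> T -> 'cV[R]_d0)
  (x : nat -> T -> 'cV[R]_d0) (v : nat -> T -> 'cV[R]_d1)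
  (q : nat -> T -> 'cV[R]_d2) (c : nat -> T -> 'cV[R]_(d1 + d2))
  (stilde : nat -> T -> 'cV[R]_r) (s : nat -> T -> 'cV[R]_d1)
  (ytilde : nat -> T -> 'cV[R]_r) (e ehat xhat : nat -> T -> 'cV[R]_d0).
Context (hrank : \rank B1 = r) (hr : (r <= d0)%N).
Context (hchannel : channel_decomposition B1 W Gamma0 Gamma1 psi U1 Pi1).
Context (hscheme : implicit_coordination P n tau A B1 B2 W K D Gamma0 Gamma1
                 (diag_mx psi) S x0 xs w x v q c stilde s ytilde e ehat xhat).

(** The scheme updates [e] and [xhat] separately by opposite increments. This links the covariance
    in the theorem to the process on which the recursion runs. *)
Lemma estimation_errorE t om : (t <= n)%N -> xs om - xhat t om = e t om.
Proof.
elim: t => [|t IH] tn.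
  by rewrite (ic_xhat_init hscheme) (ic_e_init hscheme) subr0.
by rewrite (ic_xhat hscheme)// (ic_e hscheme)// -IH ?(ltnW tn)// opprD addrA.
Qed.

(** The terms in [x t], [K t] and [c t] cancel, leaving [B1 s_t + w_t]; the two orthogonal factors
    of the SVD are undone by [Gamma1] in [s] and by [Gamma0^T] in [ytilde]. *)
Lemma channel_output t om : (t < n)%N ->
  ytilde t om = diag_mx psi *m stilde t om + pid_mx r *m (Gamma0^T *m w t om).
Proof.
move=> tn; rewrite (ic_ytilde hscheme)// (ic_x hscheme)// (ic_v hscheme)//.
rewrite (ic_q hscheme)//.
have rd1 : (r <= d1)%N by rewrite -hrank rank_leq_col.
have KE : row_mx B1 B2 *m K t =
    B1 *m usubmx (K t) + B2 *m dsubmx (K t).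
  by rewrite -{1}[K t]vsubmxK mul_row_col.
have cE : row_mx B1 B2 *m c t om =
    B1 *m usubmx (c t om) + B2 *m dsubmx (c t om).
  by rewrite -{1}[c t om]vsubmxK mul_row_col.
have -> : A *m x t om
    + B1 *m (- (usubmx (K t) *m x t om) + usubmx (c t om) + s t om)
    + B2 *m (- (dsubmx (K t) *m x t om) + dsubmx (c t om)) + w t om
    - (A - row_mx B1 B2 *m K t) *m x t om - row_mx B1 B2 *m c t om
    = B1 *m s t om + w t om.
  rewrite KE cE mulmxBl mulmxDl !mulmxDr !mulmxN !mulmxA.
  move: (A *m _) (B1 *m _ *m _) (B2 *m _ *m _) (B1 *m usubmx (c t om))
    (B2 *m dsubmx (c t om)) (B1 *m s t om) (w t om) => a1 a2 a3 a4 a5 a6 a7.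
  by apply/matrixP => i j; rewrite !mxE; ring.
rewrite !mulmxDr; congr (_ + _).
rewrite (ic_s hscheme)// (ch_svd hchannel).
rewrite -!mulmxA [Gamma1^T *m _]mulmxA (ch_Gamma1 hchannel) mul1mx.
rewrite [Gamma0^T *m _]mulmxA (ch_Gamma0 hchannel) mul1mx.
by rewrite !pid_mxKl.
Qed.

Let Psi := diag_mx psi.
Let W1 := Wbar1 r Gamma0 W.
Let H t := sqrtmx (covmx P (e t)).
Let B t : 'M[R]_(r, d0) := select_block r d0 (t %% tau).
Let L t := H t *m (B t)^T *m sqrtmx (S t) *m Psi
           *m invmx (Psi *m S t *m Psi + W1).
Let N t := 1%:M - L t *m Psi *m (sqrtmx (S t) *m B t *m invmx (H t)).
Let V t : 'M[R]_d0 := - (L t *m (pid_mx r *m Gamma0^T)).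

Lemma error_recursion t om : (t < n)%N ->
  e t.+1 om = N t *m e t om + V t *m w t om.
Proof.
move=> tn; rewrite (ic_e hscheme)// (ic_ehat hscheme)// channel_output//.
rewrite (ic_stilde hscheme)// -/Psi -/W1 -/(B t) -/(H t) -/(L t).
rewrite /N /V mulmxBl mul1mx mulNmx mulmxDr opprD addrA.
by rewrite !mulmxA.
Qed.

Context (hW : pdmx W).
Context (hw2 : forall t, square_integrable P (w t)).
Context (hwcov : forall t, covmx P (w t) = W).
Context (hww : forall t u, t != u -> crosscov P (w t) (w u) = 0).
Context (hxs2 : square_integrable P xs).
Context (hxspd : pdmx (covmx P xs)).
Context (hxsw : forall t, crosscov P xs (w t) = 0).
Context (hSpd : forall t, (t < n)%N -> pdmx (S t)).
Context (hB : forall t, (t < n)%N -> B t *m (B t)^T = 1%:M).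

(** [V] contains the projection on the first [r] rotated coordinates, whence V W V^T = L W1 L^T. *)
Lemma covmx_error_step t : (t < n)%N -> square_integrable P (e t) ->
  crosscov P (e t) (w t) = 0 ->
  covmx P (e t.+1) = N t *m covmx P (e t) *m (N t)^T + L t *m W1 *m (L t)^T.
Proof.
move=> tn e2 ew.
rewrite (_ : e t.+1 = fun om => N t *m e t om + V t *m w t om); last first.
  by apply/funext => om; exact: error_recursion.
rewrite covmx_uncorrelated// hwcov; congr (_ + _).
rewrite /V raddfN /= mulmxN !mulNmx opprK !trmx_mul trmxK tr_pid_mx.
by rewrite /W1 /Wbar1 !mulmxA.
Qed.


(** Orthogonality is stated against all noises from time [t] on, because the step to [t.+1] consumes
    [w t] and must leave the later ones uncorrelated. *)
Lemma error_invariant t : (t <= n)%N ->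
  [/\ square_integrable P (e t), pdmx (covmx P (e t)) &
      forall u, (t <= u)%N -> crosscov P (e t) (w u) = 0].
Proof.
elim: t => [|t IH] tn.
  by rewrite (ic_e_init hscheme); split => // u _; exact: hxsw.
have [e2 epd ew] := IH (ltnW tn).
have W1pd := Wbar1_pdmx hr (ch_Gamma0 hchannel) hW.
have eE : e t.+1 = fun om => N t *m e t om + V t *m w t om.
  by apply/funext => om; exact: error_recursion.
split.
- by rewrite eE; apply: square_integrableD; apply: square_integrable_mul.
- rewrite covmx_error_step ?ew//.
  exact: (error_covariance_step epd (hSpd tn) W1pd (tr_diag_mx psi) (hB tn)).1.
- move=> u tu; rewrite eE crosscovDl; try exact: square_integrable_mul.
  rewrite !crosscov_mull// ew ?(ltnW tu)// hww ?mulmx0 ?addr0//.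
  by rewrite neq_ltn tu.
  exact: hw2.
Qed.

Lemma error_covariance_recursion t : (t < n)%N ->
  covmx P (e t.+1) = covmx P (e t)
    - H t *m (B t)^T *m channel_gain (S t) W1 Psi *m B t *m H t.
Proof.
move=> tn; have [e2 epd ew] := error_invariant (ltnW tn).
have W1pd := Wbar1_pdmx hr (ch_Gamma0 hchannel) hW.
rewrite covmx_error_step ?ew//.
exact: (error_covariance_step epd (hSpd tn) W1pd (tr_diag_mx psi) (hB tn)).2.
Qed.

End closed_loop.

(** * The contraction over one period *)

Theorem theorem2 (R : realType) (d : measure_display) (T : measurableType d)
    (P : probability T R)
    (* dimensions and horizon *)
    (n d0 d1 d2 r tau : nat)
    (* system *)
    (A : 'M[R]_d0) (B1 : 'M[R]_(d0, d1)) (B2 : 'M[R]_(d0, d2))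
    (W X0 Sigma0 : 'M[R]_d0)
    (x0 xs : T -> 'cV[R]_d0) (w : nat -> T -> 'cV[R]_d0)
    (* costs and gains *)
    (F Fn : 'M[R]_d0) (G1 : 'M[R]_d1) (G2 : 'M[R]_d2)
    (Phi Dbar : nat -> 'M[R]_d0) (K D : nat -> 'M[R]_(d1 + d2, d0))
    (* channel decomposition *)
    (Gamma0 : 'M[R]_d0) (Gamma1 : 'M[R]_d1) (psi : 'rV[R]_r)
    (U1 : 'M[R]_r) (Pi1 : 'rV[R]_r)
    (S : nat -> 'M[R]_r) (Lambda : nat -> 'rV[R]_r)
    (* closed-loop processes *)
    (x : nat -> T -> 'cV[R]_d0) (v : nat -> T -> 'cV[R]_d1)
    (q : nat -> T -> 'cV[R]_d2) (c : nat -> T -> 'cV[R]_(d1 + d2))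
    (stilde : nat -> T -> 'cV[R]_r) (s : nat -> T -> 'cV[R]_d1)
    (ytilde : nat -> T -> 'cV[R]_r)
    (e ehat xhat : nat -> T -> 'cV[R]_d0)
    (sigma pimin : R)
    (hrank : \rank B1 = r) (hr : (r < d0)%N) (htau : d0 = (tau * r)%N)
    (hctrl : controllable A (row_mx B1 B2))
    (hW : pdmx W) (hX0 : psdmx X0) (hSigma0 : pdmx Sigma0)
    (hx0 : gaussian_vector P x0 X0) (hxs : gaussian_vector P xs Sigma0)
    (hw : forall t, gaussian_vector P (w t) W)
    (hindep : mutually_independent P
       (fun j => match j with 0%N => x0 | 1%N => xs | t.+2 => w t end))
    (hF : psdmx F) (hFn : psdmx Fn) (hG1 : psdmx G1) (hG2 : psdmx G2)
    (hgains : lq_gains n A (row_mx B1 B2) F Fn (block_mx G1 0 0 G2)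
                Phi Dbar K D)
    (hchannel : channel_decomposition B1 W Gamma0 Gamma1 psi U1 Pi1)
    (hSpd : forall t, (t < n)%N -> pdmx (S t))
    (hS : forall t, (t < n)%N -> S t = U1 *m diag_mx (Lambda t) *m U1^T)
    (hscheme : implicit_coordination P n tau A B1 B2 W K D Gamma0 Gamma1
                 (diag_mx psi) S x0 xs w x v q c stilde s ytilde e ehat xhat)
    (hsigma : 0 < sigma)
    (hLambda : forall t (j : 'I_r), (t < n)%N -> sigma <= Lambda t 0 j)
    (hpimin : is_min_entry Pi1 pimin) :
  forall i : nat, ((i + 1) * tau <= n)%N ->
    \tr (covmx P (fun om => xs om - xhat ((i + 1) * tau)%N om))
    <= (1 + sigma * pimin) / (1 + 2%:R * sigma * pimin)
       * \tr (covmx P (fun om => xs om - xhat (i * tau)%N om)).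
Proof.
move=> i hi.
have Wpsd := pdmx_psdmx hW; have Sig0psd := pdmx_psdmx hSigma0.
have rd := ltnW hr; have W1pd := Wbar1_pdmx rd (ch_Gamma0 hchannel) hW.
have Psiu : diag_mx psi \in unitmx.
  rewrite unitmxE det_diag unitfE; apply/prodf_neq0 => j _.
  by rewrite gt_eqF// (ch_psi hchannel).
(* The minimum is attained, hence it is an eigenvalue of Psi W1^-1 Psi, a congruence of a positive
   definite matrix. *)
have pi0 : 0 < pimin.
  have [[j <-] _] := hpimin.
  apply: (spectral_entry_gt0 _ _ (ch_U1 hchannel) (ch_Pi1 hchannel)).
  rewrite -[X in X *m _ *m _](tr_diag_mx psi).
  exact: pdmx_congr (mulVmx Psiu) (pdmx_inv W1pd).
have gain_ge t u : (t < n)%N ->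
    sigma * pimin / (1 + sigma * pimin) * qform 1%:M u <=
    qform (channel_gain (S t) (Wbar1 r Gamma0 W) (diag_mx psi)) u.
  move=> tn; apply: (channel_gain_decomposition_ge (hSpd t tn) W1pd (tr_diag_mx psi)
    Psiu (ch_U1 hchannel) (hS t tn) (ch_Pi1 hchannel)) => // [j|j].
    exact: hLambda.
  exact: hpimin.2.
have gain_sym t : (t < n)%N ->
    (channel_gain (S t) (Wbar1 r Gamma0 W) (diag_mx psi))^T =
    channel_gain (S t) (Wbar1 r Gamma0 W) (diag_mx psi).
  by move=> tn; apply: channel_gain_sym W1pd (tr_diag_mx psi); exact: hSpd.
have hw2 t := gaussian_square_integrable Wpsd (hw t).
have hwcov t := gaussian_covmx Wpsd (hw t).
have hww t u : t != u -> crosscov P (w t) (w u) = 0.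
  move=> tu; apply: (gaussian_independent_crosscov Wpsd Wpsd (hw t) (hw u)).
  (* In the joint family the indices 0 and 1 belong to [x0] and [xs], so [w t] has index [t.+2]. *)
  exact: (@mutually_independent2 _ _ _ _ _ _ t.+2 u.+2 hindep).
have hxs2 := gaussian_square_integrable Sig0psd hxs.
have hxscov := gaussian_covmx Sig0psd hxs.
have hxsw t : crosscov P xs (w t) = 0.
  apply: (gaussian_independent_crosscov Sig0psd Wpsd hxs (hw t)).
  exact: (@mutually_independent2 _ _ _ _ _ _ 1%N t.+2 hindep).
have hxspd : pdmx (covmx P xs) by rewrite hxscov.
subst d0.
(* With [tau = 0] the dimension would be 0, against [r < d0]. *)
have tau0 : (0 < tau)%N by move: hr; case: (tau).
have hB t : (t < n)%N -> select_block r (tau * r) (t %% tau) *m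
    (select_block r (tau * r) (t %% tau))^T = 1%:M :> 'M[R]_r.
  by move=> _; apply: select_blockK; rewrite leq_mul2r ltn_mod tau0 orbT.
have inv t : (t <= n)%N -> pdmx (covmx P (e t)).
  by move=> tn; have [] := error_invariant hrank rd hchannel hscheme hW hw2 hwcov
    hww hxs2 hxspd hxsw hSpd hB tn.
have rec t := error_covariance_recursion hrank rd hchannel hscheme hW hw2 hwcov
    hww hxs2 hxspd hxsw hSpd hB (t := t).
have eE t : (t <= n)%N -> (fun om => xs om - xhat t om) = e t.
  by move=> tn; apply/funext => om; exact: (estimation_errorE hscheme).
rewrite !eE//; last by apply: leq_trans hi; rewrite leq_mul2r leq_addr orbT.
set a := sigma * pimin; have a0 : 0 < a by exact: mulr_gt0.
have delta0 : 0 <= a / (1 + a) by rewrite divr_ge0 ?addr_ge0 ?ltW.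
have kn k : (k < tau)%N -> (i * tau + k < n)%N.
  move=> kt; apply: leq_trans hi; rewrite mulnDl mul1n.
  by rewrite ltn_add2l.
(* The sequence starts at [i * tau], so that the block used at offset [k] is the k-th one. *)
have := @trace_contraction R r tau (fun k => covmx P (e (i * tau + k)%N))
  (a / (1 + a)) delta0.
rewrite addn0 mulnDl mul1n => main.
have {main} : (1 + a / (1 + a)) * \tr (covmx P (e (i * tau + tau)%N)) <=
    \tr (covmx P (e (i * tau)%N)).
  have decrease t (tn : (t < n)%N) := error_covariance_decrease
    (select_block r _ (t %% tau)) (inv t (ltnW tn)) (gain_sym t tn) delta0
    (gain_ge t ^~ tn).
  apply: main => k kt; have [Zpsd Ztr] := decrease _ (kn k kt).
    by rewrite addnS rec ?kn// opprB addrC subrK.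
  rewrite addnS rec ?kn// raddfB /= lerD2l lerN2.
  by move: Ztr; rewrite modnMDl modn_small.
set tr1 := \tr _; set tr0 := \tr _ => main.
rewrite -ler_pdivlMl in main; last by rewrite ltr_pwDl.
apply: le_trans main _.
rewrite -[2%:R * _ * _]mulrA -/a le_eqVlt; apply/predU1l; congr (_ * _).
by field; rewrite !gt_eqF//; lra.
Qed.
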